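(* Let $X$ be a finite poset of dimension $n\ge2$ with a unique minimal element and a unique maximal element. Let $(B,M)$ be a local domain containing $\mathbb Q$ with $B/M$ uncountable, $|B|=|B/M|$, and $\operatorname{depth}(B)\ge2$. Suppose $\psi:X\to\operatorname{Spec}(B)$ is a dimension-preserving saturated embedding such that whenever $x\in X$ with $\operatorname{ht}(x)=1$, $Q\in\operatorname{Spec}(B)$ with $\psi(x)\subsetneq Q$, and $b\in B$, we have $Q\not\subseteq\mathfrak q$ for every $\mathfrak q\in\operatorname{Ass}(B/bB)$ and $\operatorname{depth}(B_Q)\ge2$. Let $x_1,\dots,x_m$ be the height one elements of $X$. Then there exists a local unique factorization domain $(A,M\cap A)$ such that: (1) $A\subseteq B$; (2) the inclusion induces $\widehat A=\widehat B$; (3) there are distinct nonzero elements $\widetilde{x_1},\dots,\widetilde{x_m}\in A$ with $\psi(x_i)\cap A=\widetilde{x_i}A$ for all $i$; (4) for $x,y\in X$ with $\operatorname{ht}(x)=1$, $x\le y$ if and only if $\psi(x)\cap A\subseteq\psi(y)\cap A$; (5) the map $f:\operatorname{Spec}(B)\to\operatorname{Spec}(A)$, $f(P)=A\cap P$, is surjective, and if $P\in\operatorname{Spec}(B)$ satisfies $\psi(x)\subsetneq P$ for some height one node $x$ of $X$, then $f(P)B=P$; in particular, if $P_1,P_2\in\operatorname{Spec}(B)$ each strictly contain $\psi(x)$ for some height one node $x$ and $f(P_1)=f(P_2)$, then $P_1=P_2$.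
   Context: $x<_cy$ means $x<y$ with nothing strictly between; chain length = number of elements minus one; $\dim$ = supremum of chain lengths; $\operatorname{ht}(x)$ = length of longest saturated chain from a minimal element to $x$. A saturated embedding $f$ satisfies $x\le y\iff f(x)\le f(y)$ and $x<_cy\Rightarrow f(x)<_cf(y)$; into $\operatorname{Spec}(B)$ (ordered by inclusion) it is dimension-preserving if $\dim X=\dim B$. Local = Noetherian with unique maximal ideal; $\widehat{R}$ is the completion. *)

(* Defs.v *)
From HB Require Import structures.
From mathcomp Require Import all_boot all_order all_algebra.
Set Implicit Arguments. Unset Strict Implicit. Unset Printing Implicit Defensive.
Import Order.TTheory GRing.Theory.
Local Open Scope ring_scope.

Section CommAlg.
Variable B : idomainType.
Implicit Types (R I J P Q : B -> Prop).

Definition setTB : B -> Prop := fun _ => True.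

Definition subset_ I J := forall x, I x -> J x.
Definition same_ I J := forall x, I x <-> J x.
Definition strict_sub I J := subset_ I J /\ exists x, J x /\ ~ I x.

Definition is_subring R :=
  R 1 /\ (forall x y, R x -> R y -> R (x - y)) /\ (forall x y, R x -> R y -> R (x * y)).

Definition is_ideal R I :=
  subset_ I R /\ I 0 /\ (forall x y, I x -> I y -> I (x + y)) /\
  (forall r x, R r -> I x -> I (r * x)).

Definition is_prime R I :=
  is_ideal R I /\ ~ I 1 /\ (forall a b, R a -> R b -> I (a * b) -> I a \/ I b).

Definition is_maximal R I :=
  is_ideal R I /\ ~ I 1 /\
  (forall J, is_ideal R J -> ~ J 1 -> subset_ I J -> same_ J I).

Definition ideal_span R (G : B -> Prop) (x : B) :=
  exists l : seq (B * B), (forall rp, rp \in l -> R rp.1 /\ G rp.2) /\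
    x = \sum_(rp <- l) rp.1 * rp.2.

Definition seq_set (s : seq B) : B -> Prop := fun x => x \in s.

Definition noetherian R :=
  forall I, is_ideal R I -> exists s : seq B, (forall x, x \in s -> I x) /\
    same_ I (ideal_span R (seq_set s)).

Definition is_local R m :=
  noetherian R /\ is_maximal R m /\ (forall J, is_maximal R J -> same_ J m).

Definition prods I n (x : B) :=
  exists l : seq B, size l = n /\ (forall y, y \in l -> I y) /\ x = \prod_(y <- l) y.
Definition ideal_pow R I n := ideal_span R (prods I n).

Definition cauchy R m (u : nat -> B) :=
  forall n, exists N, forall k l, (N <= k)%N -> (N <= l)%N -> ideal_pow R m n (u k - u l).
Definition null_seq R m (u : nat -> B) :=
  forall n, exists N, forall k, (N <= k)%N -> ideal_pow R m n (u k).

(* The inclusion A ⊆ B induces an isomorphism of completions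
   (A, mA)^ -> (B, M)^, completions being Cauchy sequences modulo null ones. *)
Definition completion_iso A mA M :=
  (forall u : nat -> B, (forall k, A (u k)) -> cauchy A mA u ->
      null_seq setTB M u -> null_seq A mA u) /\
  (forall v : nat -> B, cauchy setTB M v ->
      exists u : nat -> B, (forall k, A (u k)) /\ cauchy A mA u /\
        null_seq setTB M (fun k => u k - v k)).

Definition unit_in R u := R u /\ exists v, R v /\ u * v = 1.
Definition irred_in R p :=
  R p /\ p != 0 /\ ~ unit_in R p /\
  (forall a b, R a -> R b -> p = a * b -> unit_in R a \/ unit_in R b).
Definition assoc_in R a b := exists u, unit_in R u /\ a = u * b.

Definition is_ufd R :=
  (forall a, R a -> a != 0 -> ~ unit_in R a ->
     exists s : seq B, (forall p, p \in s -> irred_in R p) /\ a = \prod_(p <- s) p) /\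
  (forall s1 s2 : seq B, (forall p, p \in s1 -> irred_in R p) ->
     (forall p, p \in s2 -> irred_in R p) ->
     \prod_(p <- s1) p = \prod_(p <- s2) p ->
     size s1 = size s2 /\ exists s2', perm_eq s2 s2' /\
       forall i, (i < size s1)%N -> assoc_in R (nth 0 s1 i) (nth 0 s2' i)).

Definition regular_seq I (s : seq B) :=
  (forall x, x \in s -> I x) /\
  (forall i c, (i < size s)%N ->
     ideal_span setTB (seq_set (take i s)) (nth 0 s i * c) ->
     ideal_span setTB (seq_set (take i s)) c) /\
  ~ ideal_span setTB (seq_set s) 1.

Definition depth_ge M k := exists s, size s = k /\ regular_seq M s.

(* regular sequence on the localization B_Q in its maximal ideal Q B_Q,
   written out on fractions: z/t lies in J B_Q iff u z ∈ J for some u ∉ Q. *)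
Definition in_loc Q (J : B -> Prop) (z : B) := exists u, ~ Q u /\ J (u * z).
Definition loc_depth_ge Q k :=
  exists s : seq B, size s = k /\ (forall x, x \in s -> Q x) /\
  (forall i c, (i < size s)%N ->
     in_loc Q (ideal_span setTB (seq_set (take i s))) (nth 0 s i * c) ->
     in_loc Q (ideal_span setTB (seq_set (take i s))) c) /\
  ~ in_loc Q (ideal_span setTB (seq_set s)) 1.

Definition ass_quot (b : B) q :=
  is_prime setTB q /\ exists c, same_ q (fun y => exists a, y * c = b * a).

Definition prime_chain (c : nat -> B -> Prop) k :=
  (forall i, (i <= k)%N -> is_prime setTB (c i)) /\
  (forall i, (i < k)%N -> strict_sub (c i) (c i.+1)).
Definition krull_dim_eq n :=
  (exists c, prime_chain c n) /\ ~ (exists c, prime_chain c n.+1).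

Definition spec_cover P Q :=
  strict_sub P Q /\ ~ exists P', is_prime setTB P' /\ strict_sub P P' /\ strict_sub P' Q.

Definition contains_Q := forall n : nat, ((n.+1)%:R : B) \is a GRing.unit.

End CommAlg.

Section Posets.
Context {d : Order.disp_t} {T : finPOrderType d}.
Local Open Scope order_scope.

Definition covr (x y : T) := (x < y) && [forall z, ~~ ((x < z) && (z < y))].
Definition minimal (x : T) := forall y, y <= x -> y = x.
Definition maximal (x : T) := forall y, x <= y -> y = x.

Definition poset_dim_eq (n : nat) :=
  (exists s : seq T, sorted <%O s /\ size s = n.+1) /\
  (forall s : seq T, sorted <%O s -> (size s <= n.+1)%N).

Definition sat_chain_to (x : T) (x0 : T) (s : seq T) :=
  minimal x0 /\ path covr x0 s /\ last x0 s = x.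
Definition ht_eq (x : T) (k : nat) :=
  (exists x0 s, sat_chain_to x x0 s /\ size s = k) /\
  (forall x0 s, sat_chain_to x x0 s -> (size s <= k)%N).

Definition unique_min := exists x0 : T, minimal x0 /\ forall y, minimal y -> y = x0.
Definition unique_max := exists x0 : T, maximal x0 /\ forall y, maximal y -> y = x0.
End Posets.

Definition saturated_embedding {d} {T : finPOrderType d} {B : idomainType}
    (psi : T -> B -> Prop) :=
  (forall x, is_prime (@setTB B) (psi x)) /\
  (forall x y, (x <= y)%O <-> subset_ (psi x) (psi y)) /\
  (forall x y, covr x y -> spec_cover (psi x) (psi y)).

(* Main.v *)
Require Import Defs.
From HB Require Import structures.
From mathcomp Require Import all_boot all_order all_algebra.
From mathcomp Require Import ring.
From mathcomp Require Import boolp.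
From mathcomp Require wochoice.
Set Implicit Arguments. Unset Strict Implicit. Unset Printing Implicit Defensive.
Import Order.TTheory GRing.Theory.
Local Open Scope ring_scope.

(**
  The ring A is the union of a transfinite tower of subrings R of B that are small
  compared with B/M.  All divisibility is taken in B.  An element p of R is called
  "strongly prime" in R when every s in R is either divisible by p in B or a nonzero
  divisor on B/pB, and R is "good" when R = Frac(R) ∩ B and every nonzero element of R is
  a unit of B times a product of strong primes.  Good rings are factorial, and goodness
  passes to unions along extensions preserving strong primes.

  If R is good, x in B is transcendental over R, and every strong prime of R stays one in
  S = Frac(R)(x) ∩ B, then S is good.  A strong prime p of R persists as soon as f(x) is
  regular modulo p for every f in R[X] not divisible by p.  Since B/pB has finitely many
  maximal associated primes q, this excludes only few residues m when x = a + s m with s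
  outside these q, and R has fewer than |B/M| elements.  Such an s exists in M and in every
  prime strictly containing some psi(x), because these primes lie in no associated prime
  of a principal ideal.

  In this way one successively hits every residue class (s in M), makes every prime P
  strictly containing a psi(x) be generated by P ∩ A (s in M P, then Nakayama), and solves
  over A every linear equation over A that is solvable in B.  The last point gives
  IB ∩ A = I for all finitely generated ideals I of A; hence A is Noetherian with the
  completion of B, and Spec B -> Spec A is onto.  The tower starts from the field of
  rationals with generic elements of the height one primes psi(x_i) adjoined.  These stay
  strongly prime, so they generate psi(x_i) ∩ A, which consists of zero divisors modulo
  them.
*)

(** * Divisibility in B, strong primes and good subrings *)

Section Divisibility.
Variable B : idomainType.
Implicit Types (R S I J P Q : B -> Prop) (a b c p s t x y : B).

Definition dvd a b := exists c, b = a * c.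
Definition regmod p s := forall c, dvd p (s * c) -> dvd p c.

Lemma dvd_refl a : dvd a a.
Proof. by exists 1; rewrite mulr1. Qed.

Lemma dvd_trans b a c : dvd a b -> dvd b c -> dvd a c.
Proof. by move=> [x ->] [y ->]; exists (x * y); rewrite mulrA. Qed.

Lemma dvd_mulr a b c : dvd a b -> dvd a (b * c).
Proof. by move=> [x ->]; exists (x * c); rewrite mulrA. Qed.

Lemma dvd_mull a b c : dvd a b -> dvd a (c * b).
Proof. by rewrite mulrC; apply: dvd_mulr. Qed.

Lemma dvd_add a b c : dvd a b -> dvd a c -> dvd a (b + c).
Proof. by move=> [x ->] [y ->]; exists (x + y); rewrite mulrDr. Qed.

Lemma dvd0 a : dvd a 0.
Proof. by exists 0; rewrite mulr0. Qed.

Lemma unit_dvd1 x : x \is a GRing.unit <-> dvd x 1.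
Proof.
split=> [ux|[y e]]; first by exists x^-1; rewrite divrr.
by apply/unitrP; exists y; rewrite mulrC -e.
Qed.

Lemma regmod_dvd p a : regmod p a -> dvd p a -> dvd p 1.
Proof. by move=> h pa; apply: h; rewrite mulr1. Qed.

Lemma regmod_mul p a b : regmod p a -> regmod p b -> regmod p (a * b).
Proof. by move=> ha hb c; rewrite -mulrA => /ha/hb. Qed.

Lemma regmod_factor p a b : regmod p (a * b) -> regmod p a.
Proof. by move=> h c pc; apply: h; rewrite mulrAC; apply: dvd_mulr. Qed.

Lemma regmod1 p : regmod p 1.
Proof. by move=> c; rewrite mul1r. Qed.

Lemma regmod_unit p u : u \is a GRing.unit -> regmod p u.
Proof. by move=> uu c [d e]; exists (u^-1 * d); rewrite mulrCA -e mulKr. Qed.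

Lemma regmod_prod p (l : seq B) :
  (forall s, s \in l -> regmod p s) -> regmod p (\prod_(s <- l) s).
Proof.
elim: l => [|s l IH] h; first by rewrite big_nil; apply: regmod1.
rewrite big_cons; apply: regmod_mul; first by apply/h/mem_head.
by apply: IH => t tl; apply: h; rewrite inE tl orbT.
Qed.

(** From p c = s d, regularity of s modulo p gives d = p d', and p cancels. *)
Lemma regmod_sym p s : p != 0 -> regmod p s -> regmod s p.
Proof.
move=> p0 h c [d e].
have /h [d' ed] : dvd p (s * d) by exists c.
by exists d'; apply: (mulfI p0); rewrite e ed mulrCA.
Qed.

Definition sprime R p :=
  [/\ R p, p != 0, ~ dvd p 1 & forall s, R s -> dvd p s \/ regmod p s].

(** For a subring this is the condition R = Frac(R) ∩ B. *)
Definition saturated R := forall s t, R t -> t != 0 -> R (t * s) -> R s.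

Definition factorable R s := exists (u : B) (l : seq B),
  [/\ u \is a GRing.unit, forall p, p \in l -> sprime R p & s = u * \prod_(p <- l) p].

Record good R : Prop := Good {
  good_ring : is_subring R;
  good_sat : saturated R;
  good_fact : forall s, R s -> s != 0 -> factorable R s }.

Definition ext R S := subset_ R S /\ forall p, sprime R p -> sprime S p.

Lemma ext_refl R : ext R R.
Proof. by split. Qed.

Lemma ext_trans S R R' : ext R S -> ext S R' -> ext R R'.
Proof. by move=> [h1 h2] [h3 h4]; split=> [x /h1/h3|p /h2/h4]. Qed.

Section Subring.
Variable R : B -> Prop.
Hypothesis hR : is_subring R.

Lemma sub1 : R 1. Proof. by case: hR. Qed.
Lemma subB x y : R x -> R y -> R (x - y). Proof. by case: hR => _ [h _]; apply: h. Qed.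
Lemma subM x y : R x -> R y -> R (x * y). Proof. by case: hR => _ [_ h]; apply: h. Qed.
Lemma sub0 : R 0. Proof. by rewrite -(subrr 1); apply: subB; apply: sub1. Qed.
Lemma subN x : R x -> R (- x).
Proof. by move=> h; rewrite -sub0r; apply: subB => //; apply: sub0. Qed.
Lemma subD x y : R x -> R y -> R (x + y).
Proof. by move=> hx hy; rewrite -[y]opprK; apply/subB/subN. Qed.
Lemma sub_prod (l : seq B) : (forall p, p \in l -> R p) -> R (\prod_(p <- l) p).
Proof.
elim: l => [|s l IH] h; first by rewrite big_nil; apply: sub1.
rewrite big_cons; apply: subM; first by apply/h/mem_head.
by apply: IH => t tl; apply: h; rewrite inE tl orbT.
Qed.

Hypothesis sR : saturated R.

Lemma sat_unit u : R u -> u \is a GRing.unit -> R u^-1.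
Proof.
move=> Ru uu; apply: (sR Ru); last by rewrite divrr //; apply: sub1.
by apply: contraTneq uu => ->; rewrite unitr0.
Qed.

(** Induction on the number of strong primes in the factorization of a b. The first one divides a,
    or a is regular modulo it and then it divides b; saturation keeps the quotient in R. *)
Lemma factorable_dvd a b : R a -> R b -> a * b != 0 ->
  factorable R (a * b) -> factorable R a.
Proof.
move=> Ra Rb ab0 [u [l [uu hl e]]].
elim: l a b Ra Rb ab0 u uu hl e => [|p l IH] a b Ra Rb ab0 u uu hl e.
  move: e; rewrite big_nil mulr1 => e.
  exists a, [::]; split => //; last by rewrite big_nil mulr1.
  by move: uu; rewrite -e unitrM => /andP[].
have [Rp p0 np1 hp] := hl p (mem_head _ _).
have hl' q : q \in l -> sprime R q by move=> ql; apply: hl; rewrite inE ql orbT.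
have pd : dvd p (a * b).
  by exists (u * \prod_(p <- l) p); rewrite e big_cons mulrCA.
have [[a' ea]|ra] := hp a Ra.
  have Ra' : R a' by apply: (sR Rp); rewrite -?ea.
  have a'b : a' * b = u * \prod_(p <- l) p.
    by apply: (mulfI p0); rewrite mulrA -ea e big_cons mulrCA.
  have a'b0 : a' * b != 0.
    by apply: contraNneq ab0; rewrite ea -mulrA => ->; rewrite mulr0.
  have [v [k [uv hk ek]]] := IH a' b Ra' Rb a'b0 u uu hl' a'b.
  exists v, (p :: k); split=> //; last by rewrite big_cons mulrCA -ek ea.
  by move=> q; rewrite inE => /orP[/eqP->|/hk //]; apply: hl; apply: mem_head.
have [b' eb] := ra _ pd.
have Rb' : R b' by apply: (sR Rp); rewrite -?eb.
apply: (IH a b' Ra Rb' _ u uu hl'); last first.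
  by apply: (mulfI p0); rewrite mulrCA -eb e big_cons mulrCA.
by apply: contraNneq ab0 => h; rewrite eb mulrCA h mulr0.
Qed.

Lemma factorable_mul a b : factorable R a -> factorable R b -> factorable R (a * b).
Proof.
move=> [u [l [uu hl ->]]] [v [k [uv hk ->]]]; exists (u * v), (l ++ k).
split; [by rewrite unitrM uu | | by rewrite big_cat mulrACA].
by move=> p; rewrite mem_cat => /orP[/hl|/hk].
Qed.

End Subring.

Lemma factorable_ext R S s : ext R S -> factorable R s -> factorable S s.
Proof. by move=> [_ h] [u [l [uu hl e]]]; exists u, l; split=> // p /hl/h. Qed.

(** Both alternatives in [sprime] refer to divisibility in B, so they do not depend on the ring; any
    s of the union lies together with p in a common member, where p is still a strong prime. *)
Lemma good_union (X : Type) (F : X -> B -> Prop) :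
  (exists i : X, True) ->
  (forall i j, exists k, ext (F i) (F k) /\ ext (F j) (F k)) ->
  (forall i, good (F i)) ->
  good (fun x => exists i, F i x) /\ forall i, ext (F i) (fun x => exists i, F i x).
Proof.
move=> [i0 _] dir gF.
have sp i p : sprime (F i) p -> sprime (fun x => exists i, F i x) p.
  move=> hp; have [Fp p0 np _] := hp.
  split=> //; first by exists i.
  move=> s [j Fs]; have [k [[_ ik] [jk _]]] := dir i j.
  by have [_ _ _ h] := ik p hp; apply/h/jk.
split; last by move=> i; split=> [x h|]; [exists i | apply: sp].
split.
- split; first by exists i0; case: (gF i0) => -[].
  by split=> x y [i Fx] [j Fy]; have [k [[ik _] [jk _]]] := dir i j; exists k;
    [apply: subB | apply: subM]; try exact: good_ring; [apply: ik|apply: jk| apply: ik|apply: jk].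
- move=> s t [i Ft] t0 [j Fts]; have [k [[ik _] [jk _]]] := dir i j; exists k.
  by apply: (good_sat (gF k) _ t0); [apply: ik| apply: jk].
- move=> s [i Fs] s0; have [u [l [uu hl e]]] := good_fact (gF i) Fs s0.
  by exists u, l; split=> // p /hl /sp.
Qed.

End Divisibility.

(** * Ideals of a Noetherian domain *)

Section Ideals.
Variable B : idomainType.
Implicit Types (R S I J P Q : B -> Prop) (a b c p s t x y : B).

Lemma span_sub R I (G : B -> Prop) :
  is_ideal R I -> subset_ G I -> subset_ (ideal_span R G) I.
Proof.
move=> [_ [I0 [ID IM]]] GI x [l [hl ->]].
elim: l hl => [|rp l IH] hl; first by rewrite big_nil.
rewrite big_cons; apply: ID.
  by have [r g] := hl rp (mem_head _ _); apply/IM/GI.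
by apply: IH => q ql; apply: hl; rewrite inE ql orbT.
Qed.

Lemma span_mem R G x : R 1 -> G x -> ideal_span R G x.
Proof.
move=> R1 Gx; exists [:: (1, x)]; split; last by rewrite big_seq1 mul1r.
by move=> rp; rewrite inE => /eqP->.
Qed.

Lemma span_mono R G G' : subset_ G G' -> subset_ (ideal_span R G) (ideal_span R G').
Proof. by move=> h x [l [hl ->]]; exists l; split=> // rp /hl[? /h]. Qed.

Lemma span_ideal R G : is_subring R -> subset_ G R -> is_ideal R (ideal_span R G).
Proof.
move=> hR GR; split.
  move=> x [l [hl ->]]; elim: l hl => [|rp l IH] hl.
    by rewrite big_nil; apply: sub0.
  rewrite big_cons; apply: subD => //.
    by have [? /GR ?] := hl rp (mem_head _ _); apply: subM.
  by apply: IH => q ql; apply: hl; rewrite inE ql orbT.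
split; first by exists [::]; rewrite big_nil.
split=> [x y [l [hl ->]] [k [hk ->]]|r x Rr [l [hl ->]]].
  exists (l ++ k); rewrite big_cat; split=> // rp.
  by rewrite mem_cat => /orP[/hl|/hk].
exists [seq (r * q.1, q.2) | q <- l]; split.
  by move=> rp /mapP[q /hl[Rq Gq] ->]; split=> //; apply: subM.
by rewrite big_map mulr_sumr; apply: eq_bigr => q _; rewrite mulrA.
Qed.

Lemma setTB_ring : is_subring (@setTB B).
Proof. by []. Qed.

Lemma principal_ideal a : is_ideal (@setTB B) (dvd a).
Proof.
split=> //; split; first exact: dvd0.
by split=> [x y|r x _]; [apply: dvd_add | apply: dvd_mull].
Qed.

Definition idealT I := [/\ I 0, forall x y, I x -> I y -> I (x + y) &
  forall r x, I x -> I (r * x)].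

Lemma idealTP I : is_ideal (@setTB B) I <-> idealT I.
Proof.
split=> [[_ [h0 [hD hM]]]|[h0 hD hM]]; first by split=> // r x; apply: hM.
by do 3!split=> //; move=> r x _; apply: hM.
Qed.

Hypothesis noethB : noetherian (@setTB B).

(** Without a maximal member, choice yields a strictly ascending sequence of ideals; but finitely
    many generators of its union lie in a single term. *)
Lemma noetherian_max (Pr : (B -> Prop) -> Prop) :
  (forall J, Pr J -> idealT J) -> (exists J, Pr J) ->
  exists J, Pr J /\ forall K, Pr K -> subset_ J K -> subset_ K J.
Proof.
move=> PrI [J0 PJ0]; apply: contrapT => nomax.
have /choice[f hf] (J : {J | Pr J}) : exists K : {J | Pr J},
    subset_ (sval J) (sval K) /\ ~ subset_ (sval K) (sval J).
  apply: contrapT => h; apply: nomax; exists (sval J); split; first exact: (svalP J).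
  move=> K PK JK; apply: contrapT => KJ; apply: h.
  by exists (exist _ K PK).
pose u n := sval (iter n f (exist _ J0 PJ0)).
have uI n : idealT (u n) by apply: PrI; apply: svalP.
have uS n : subset_ (u n) (u n.+1) by have [] := hf (iter n f (exist _ J0 PJ0)).
have um m n : (m <= n)%N -> subset_ (u m) (u n).
  move=> /subnK <-; elim: (n - m)%N => [|k IH] // x /IH.
  by rewrite addSn; apply: uS.
have Uideal : is_ideal (@setTB B) (fun x => exists n, u n x).
  apply/idealTP; split; first by exists 0%N; have [] := uI 0%N.
  - move=> x y [m mx] [n ny]; exists (maxn m n); have [_ h _] := uI (maxn m n).
    by apply: h; [apply: um mx; rewrite leq_maxl | apply: um ny; rewrite leq_maxr].
  - by move=> r x [m mx]; exists m; have [_ _ h] := uI m; apply: h.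
have [s [sU Us]] := noethB Uideal.
have [N hN] : exists N, forall x, x \in s -> u N x.
  elim: s sU {Us} => [|a s IH] sU; first by exists 0%N.
  have [|N hN] := IH; first by move=> x xs; apply: sU; rewrite inE xs orbT.
  have [m um'] := sU a (mem_head _ _).
  exists (maxn m N) => x; rewrite inE => /orP[/eqP->|/hN uN].
    by apply: um um'; rewrite leq_maxl.
  by apply: um uN; rewrite leq_maxr.
have [_] := hf (iter N f (exist _ J0 PJ0)); apply.
move=> x xN; have : exists n, u n x by exists N.+1.
by move=> /Us; apply: span_sub => //; apply/idealTP/uI.
Qed.

(** Well-founded induction on proper divisors, from the ascending chain condition on principal
    ideals. *)
Lemma dvd_acc_ind (Pr : B -> Prop) :
  (forall b, (forall a, dvd a b -> ~ dvd b a -> Pr a) -> Pr b) -> forall b, Pr b.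
Proof.
move=> step b0; apply: contrapT => nb0.
have [||J [[a [na aJ]] Jmax]] := @noetherian_max (fun J =>
    exists a, ~ Pr a /\ same_ J (dvd a)).
- move=> J [a [_ e]]; have /idealTP [h1 h2 h3] := principal_ideal a.
  split; first exact/e.
  + by move=> x y /e hx /e hy; apply/e/h2.
  + by move=> r x /e hx; apply/e/h3.
- by exists (dvd b0), b0.
apply: na; apply: step => c ca nac; apply: contrapT => nc.
apply: nac; have /Jmax : exists d, ~ Pr d /\ same_ (dvd c) (dvd d) by exists c.
move=> h; apply/aJ/h; last exact: dvd_refl.
by move=> x /aJ; apply: dvd_trans.
Qed.

(* Krull's prime-avoiding-a-multiplicative-set argument. *)
Lemma prime_disjoint (U : B -> Prop) I :
  U 1 -> (forall x y, U x -> U y -> U (x * y)) -> idealT I ->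
  (forall x, I x -> ~ U x) ->
  exists P, [/\ is_prime (@setTB B) P, subset_ I P & forall x, P x -> ~ U x].
Proof.
move=> U1 UM hI IU.
have [||P [[hP IP PU] Pmax]] := @noetherian_max (fun J =>
  [/\ idealT J, subset_ I J & forall x, J x -> ~ U x]).
- by move=> J [].
- by exists I; split=> // x.
have [P0 PD PM] := hP.
exists P; split=> //; split; first exact/idealTP.
split=> [P1|a b _ _ Pab]; first exact: (PU 1).
have key c : ~ P c -> exists u y, [/\ U u, P y & exists r, u = y + r * c].
  move=> nPc; apply: contrapT => h; apply: nPc.
  pose K x := exists y r, P y /\ x = y + r * c.
  have PK : subset_ P K by move=> x Px; exists x, 0; rewrite mul0r addr0.
  have Kc : K c by exists 0, 1; rewrite mul1r add0r.
  apply: (Pmax K) Kc => //; split.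
  - split; first by exists 0, 0; rewrite mul0r addr0.
    + move=> x y [x' [r [Px ->]]] [y' [r' [Py ->]]].
      by exists (x' + y'), (r + r'); split; [apply: PD | ring].
    + by move=> r x [x' [r' [Px ->]]]; exists (r * x'), (r * r'); split; [apply: PM | ring].
  - by move=> x /IP/PK.
  - by move=> x [y [r [Py e]]] Ux; apply: h; exists x, y; split=> //; exists r.
have [Pa|nPa] := EM (P a); first by left.
have [Pb|nPb] := EM (P b); first by right.
have [u [y [Uu Py [r eu]]]] := key a nPa; have [v [z [Uv Pz [r' ev]]]] := key b nPb.
case: (PU (u * v) _ (UM _ _ Uu Uv)).
have -> : u * v = v * y + (r * a) * z + r * r' * (a * b) by rewrite eu ev; ring.
by apply: (PD); [apply: PD; apply: PM | apply: PM].
Qed.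

End Ideals.

(** * Polynomials over a saturated subring and their values at an element of B *)

Record satsub (B : idomainType) := SatSub {
  ss_set :> B -> Prop;
  ss_ring : is_subring ss_set;
  ss_sat : saturated ss_set }.

Section SatSubType.
Variables (B : idomainType) (A : satsub B).

Definition ss_mem : {pred B} := fun x => `[<A x>].

Lemma ss_memP x : reflect (A x) (x \in ss_mem).
Proof. exact: asboolP. Qed.

Fact ss_divring_closed : divring_closed ss_mem.
Proof.
have hA := ss_ring A; split.
- exact/ss_memP/(sub1 hA).
- by move=> x y /ss_memP hx /ss_memP hy; apply/ss_memP/(subB hA).
- move=> x y /ss_memP hx /ss_memP hy; apply/ss_memP/(subM hA) => //.
  (* The inverse of a non-unit is by convention the element itself; inverses of units lie in A by
     saturation. *)
  have [uy|nuy] := boolP (y \is a GRing.unit); last by rewrite invr_out.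
  exact: (sat_unit hA (ss_sat (s := A))).
Qed.

HB.instance Definition _ := GRing.isDivringClosed.Build B ss_mem ss_divring_closed.

(** A as a type with its own integral domain structure, which makes polynomials over A and their
    pseudo-division available. *)
Record ss_type := SsElem { ss_val :> B; ss_valP : ss_val \in ss_mem }.
HB.instance Definition _ := [isSub for ss_val].
HB.instance Definition _ := [Choice of ss_type by <:].
HB.instance Definition _ := [SubChoice_isSubIntegralDomain of ss_type by <:].

Lemma ss_valA (a : ss_type) : A (val a).
Proof. exact/ss_memP/ss_valP. Qed.

Definition ss_elem x (Ax : A x) : ss_type := SsElem (introT (ss_memP x) Ax).

Definition ev (x : B) (f : {poly ss_type}) : B := (map_poly val f).[x].

Lemma evM x f g : ev x (f * g) = ev x f * ev x g.
Proof. by rewrite /ev rmorphM hornerM. Qed.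
Lemma evD x f g : ev x (f + g) = ev x f + ev x g.
Proof. by rewrite /ev rmorphD hornerD. Qed.
Lemma evN x f : ev x (- f) = - ev x f.
Proof. by rewrite /ev rmorphN hornerN. Qed.
Lemma evC x c : ev x c%:P = val c.
Proof. by rewrite /ev map_polyC hornerC. Qed.
Lemma evZ x c f : ev x (c *: f) = val c * ev x f.
Proof. by rewrite -mul_polyC evM evC. Qed.
Lemma evX x : ev x 'X = x.
Proof. by rewrite /ev map_polyX hornerX. Qed.
Lemma ev0 x : ev x 0 = 0.
Proof. by rewrite /ev rmorph0 horner0. Qed.
Lemma ev1 x : ev x 1 = 1.
Proof. by rewrite /ev rmorph1 hornerC. Qed.

(* Frac(A)(x) ∩ B *)
Definition adj x (b : B) := exists f g, ev x g != 0 /\ ev x g * b = ev x f.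

Lemma adj_ring x : is_subring (adj x).
Proof.
split; first by exists 1, 1; rewrite ev1 mul1r oner_neq0.
split=> b c [f [g [g0 e]]] [f' [g' [g0' e']]].
  exists (f * g' - g * f'), (g * g'); rewrite evD evN !evM mulf_neq0 //.
  by split=> //; rewrite -e -e'; ring.
exists (f * f'), (g * g'); rewrite !evM mulf_neq0 //; split=> //.
by rewrite -e -e'; ring.
Qed.

Lemma adj_sat x : saturated (adj x).
Proof.
move=> s t [f [g [g0 e]]] t0 [f' [g' [g0' e']]].
exists (f' * g), (g' * f); rewrite !evM -e !mulf_neq0 //; split=> //.
by rewrite -e'; ring.
Qed.

Lemma adj_sub x : subset_ A (adj x).
Proof.
by move=> a Aa; exists (ss_elem Aa)%:P, 1; rewrite ev1 oner_neq0 evC mul1r.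
Qed.

Lemma adj_gen x : adj x x.
Proof. by exists 'X, 1; rewrite ev1 oner_neq0 evX mul1r. Qed.

Lemma adj_ev x f : adj x (ev x f).
Proof. by exists f, 1; rewrite ev1 oner_neq0 mul1r. Qed.

Lemma ev_in (S : B -> Prop) x f : is_subring S -> subset_ A S -> S x -> S (ev x f).
Proof.
move=> hS AS Sx; elim/poly_ind: f => [|f c IH]; first by rewrite ev0; apply: sub0.
rewrite evD evM evX evC; apply: subD => //; first exact: subM.
exact/AS/ss_valA.
Qed.

Lemma adj_min (S : B -> Prop) x :
  is_subring S -> saturated S -> subset_ A S -> S x -> subset_ (adj x) S.
Proof.
move=> hS sS AS Sx b [f [g [g0 e]]]; apply: sS g0 _; first exact: ev_in.
by rewrite e; apply: ev_in.
Qed.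

Definition allcoef (p : B) (f : {poly ss_type}) := forall i, dvd p (val f`_i).

Lemma allcoef_div p f : A p -> p != 0 -> allcoef p f ->
  exists (p' : ss_type) f', val p' = p /\ f = p' *: f'.
Proof.
move=> Ap p0 h; exists (ss_elem Ap).
have /choice[c hc] i : exists c : ss_type, f`_i = ss_elem Ap * c.
  have [d e] := h i; have Ad : A d.
    by apply: (ss_sat Ap p0); rewrite -e; apply: ss_valA.
  by exists (ss_elem Ad); apply: val_inj; rewrite rmorphM.
exists (\poly_(i < size f) c i); split=> //; apply/polyP => i.
rewrite coefZ coef_poly; case: ltnP => hi; first exact: hc.
by rewrite mulr0 nth_default.
Qed.

Definition generic (p x : B) := forall f, ~ allcoef p f -> regmod p (ev x f).

Hypothesis noethB : noetherian (@setTB B).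

(** An element s of the new ring satisfies g(x) s = f(x). By genericity p divides every coefficient
    of a polynomial whose value it divides, so common factors p of f and g can be cancelled; this
    ends by Noetherian induction on the leading coefficient of g. Once p does not divide g, the
    value g(x) is regular modulo p and the alternative for s is read off from f. *)
Lemma sprime_adj p x : sprime A p -> generic p x -> sprime (adj x) p.
Proof.
move=> [Ap p0 np1 hp] gx; split=> //; first exact: adj_sub.
move=> s [f [g [g0 e]]].
have key (f' : {poly ss_type}) : dvd p (ev x f') -> allcoef p f'.
  move=> pf; apply: contrapT => /gx /regmod_dvd h; exact/np1/h.
pose Pr l := forall f g, val (lead_coef g) = l -> ev x g != 0 ->
  ev x g * s = ev x f -> dvd p s \/ regmod p s.
suff /(_ _ _ _ erefl g0 e) : forall l, Pr l by [].
apply: (dvd_acc_ind noethB) => l IH {}f {}g el {}g0 {}e.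
have [pg|npg] := EM (allcoef p g).
  have [p' [g' [ep' eg]]] := allcoef_div Ap p0 pg.
  have [|p'' [f' [ep'' ef]]] := @allcoef_div p f Ap p0.
    by apply: key; rewrite -e eg evZ ep' -mulrA; exists (ev x g' * s).
  have pp : p'' = p' by apply: val_inj; rewrite ep' ep''.
  have g'0 : ev x g' != 0.
    by apply: contraNneq g0; rewrite eg evZ => ->; rewrite mulr0.
  have lg' : val (lead_coef g') != 0.
    rewrite (inj_eq val_inj _ 0) lead_coef_eq0.
    by apply: contraNneq g'0 => ->; rewrite ev0.
  have el' : l = p * val (lead_coef g').
    by rewrite -el eg lead_coefZ rmorphM /= ep'.
  apply: (IH (val (lead_coef g')) _ _ f' g') => //.
  - by rewrite el'; exists p; rewrite mulrC.
  - rewrite el' => -[d ed]; apply: np1; exists d.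
    by apply: (mulfI lg'); rewrite mulr1 [LHS]ed; ring.
  - apply: (mulfI p0); rewrite mulrA -{1}ep' -evZ -eg e ef evZ pp ep' //.
have rg := gx g npg.
have [pf|npf] := EM (allcoef p f).
  have [p' [f' [ep' ef]]] := allcoef_div Ap p0 pf.
  by left; apply: rg; rewrite e ef evZ ep'; exists (ev x f').
by right; apply: (@regmod_factor _ p s (ev x g)); rewrite mulrC e; apply: gx.
Qed.

End SatSubType.

(** * Adjoining a transcendental element keeps a ring good *)

Section Adjunction.
Variables (B : idomainType) (A : satsub B) (x : B).
Hypothesis noethB : noetherian (@setTB B).
Hypothesis gA : good A.
Hypothesis transc : forall f : {poly ss_type A}, f != 0 -> ev x f != 0.
Hypothesis persist : forall p, sprime A p -> sprime (adj A x) p.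
Let S := adj A x.
Let hS : is_subring S := @adj_ring B A x.
Let sS : saturated S := @adj_sat B A x.
Implicit Types (f g h : {poly ss_type A}).

Lemma pull_sprimes s : s != 0 -> exists (l : seq B) s',
  [/\ forall p, p \in l -> sprime A p, s = (\prod_(p <- l) p) * s' &
      forall p, sprime A p -> ~ dvd p s'].
Proof.
elim/(dvd_acc_ind noethB): s => s IH s0.
have [[p [hp [s1 e1]]]|no] := EM (exists p, sprime A p /\ dvd p s); last first.
  by exists [::], s; split=> //; [rewrite big_nil mul1r | move=> p hp ps; apply: no; exists p].
have [_ p0 np1 _] := hp.
have s10 : s1 != 0 by apply: contraNneq s0; rewrite e1 => ->; rewrite mulr0.
have [||l [s' [hl es hs']]] := IH s1 _ _ s10.
- by exists p; rewrite mulrC.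
- move=> [d ed]; apply: np1; exists d; apply: (mulfI s10).
  by rewrite mulr1 [LHS]ed e1; ring.
- exists (p :: l), s'; split=> //; last by rewrite big_cons e1 es mulrA.
  by move=> q; rewrite inE => /orP[/eqP->|/hl].
Qed.

(** By symmetry of regularity every strong prime of A is regular modulo s', hence so is every
    nonzero constant. This permits clearing denominators modulo s'. *)
Lemma regmod_base s' (r : ss_type A) :
  (forall p, sprime A p -> regmod p s') -> r != 0 -> regmod s' (val r).
Proof.
move=> hs' r0; have vr0 : val r != 0 by rewrite (inj_eq val_inj _ 0).
have [u [l [uu hl ->]]] := good_fact gA (ss_valA r) vr0.
apply: regmod_mul; first exact: regmod_unit.
apply: regmod_prod => p /hl hp; apply: regmod_sym; first by case: hp.
exact: hs'.
Qed.

(** Over the domain A, [irreducible_poly] amounts to irreducibility over Frac(A). A polynomial h is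
    either divisible by f, and then s' divides h(x), or coprime to f, and then a Bezout identity
    makes h(x) regular modulo s'. This is applied to numerator and denominator of an element of
    S. *)
Lemma sprime_irred f s' e : irreducible_poly f -> S s' -> A e -> e != 0 ->
  e * s' = ev x f -> (forall p, sprime A p -> regmod p s') ->
  ~ dvd s' 1 -> sprime S s'.
Proof.
move=> irf Ss' Ae e0 es' hs' nu; have [szf irrf] := irf.
have fd h : dvdp f h -> dvd s' (ev x h).
  move=> /Pdiv.Idomain.dvdpP[[c q] /= c0 ehq].
  apply: (regmod_base hs' c0); rewrite -evZ ehq evM -es'.
  by exists (ev x q * e); ring.
have fc h : coprimep f h -> regmod s' (ev x h).
  move=> /Pdiv.Idomain.Bezout_coprimepP[[u v] /=].
  rewrite -Pdiv.Idomain.size_poly_eq1 => /size_poly1P[c c0 euv] b sb.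
  apply: (regmod_base hs' c0); rewrite -(evC x c) -euv evD !evM -es' mulrDl.
  apply: dvd_add; first by exists (ev x u * e * b); ring.
  by rewrite -mulrA; apply: dvd_mull.
have cases h : dvdp f h \/ coprimep f h.
  have [cfh|ncfh] := boolP (coprimep f h); first by right.
  left; have := irrf (gcdp f h) ncfh (Pdiv.Idomain.dvdp_gcdl _ _).
  move=> /Pdiv.Idomain.eqp_dvdl <-; exact: Pdiv.Idomain.dvdp_gcdr.
have f0 : f != 0 by rewrite -size_poly_gt0; apply: leq_trans szf.
split=> //.
  by apply: contraTneq (transc f0) => s0; rewrite -es' s0 mulr0 eqxx.
move=> t [h [g [g0 egh]]].
have [n] := ubnP (size g); elim: n h g g0 egh => // n IH h g g0 egh szg.
(* If f divides both, it is cancelled and the size of g drops. If it divides g only, the regular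
   element h(x) = g(x) t is divisible by s', although s' is not a unit. In the remaining cases s'
   divides t or t is regular. *)
have [fg|cg] := cases g; have [fh|ch] := cases h.
- have [[c q] /= c0 eg] := Pdiv.Idomain.dvdpP _ _ fg.
  have [[c' q'] /= c'0 eh] := Pdiv.Idomain.dvdpP _ _ fh.
  have vc'0 : val c' != 0 by rewrite (inj_eq val_inj _ 0).
  have vc0 : val c != 0 by rewrite (inj_eq val_inj _ 0).
  have gn0 : g != 0 by apply: contraNneq g0 => ->; rewrite ev0.
  have q0 : q != 0.
    apply: contraNneq gn0 => q0; move/eqP: eg.
    by rewrite q0 mul0r scale_poly_eq0 (negbTE c0).
  apply: (IH (c *: q') (c' *: q)).
  + by rewrite evZ mulf_neq0 // transc.
  + apply: (mulfI (transc f0)); rewrite !evZ.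
    have e1 : ev x q * ev x f = val c * ev x g by rewrite -evM -eg evZ.
    have e2 : ev x q' * ev x f = val c' * ev x h by rewrite -evM -eh evZ.
    have -> : ev x f * (val c * ev x q') = val c * (ev x q' * ev x f) by ring.
    rewrite e2 -egh.
    have -> : ev x f * (val c' * ev x q * t) = val c' * (ev x q * ev x f) * t by ring.
    by rewrite e1; ring.
  + rewrite size_scale //; have := congr1 (size \o polyseq) eg.
    rewrite /= size_scale // size_mul // => esz.
    move: szg szf; rewrite esz; case: (size f) => [|[|k]] //.
    by rewrite !addnS /= ltnS => + _; apply: leq_ltn_trans; rewrite leq_addr.
- case: nu; apply: (regmod_dvd (fc _ ch)); rewrite -egh.
  by apply: dvd_mulr; apply: fd.
- by left; apply: (fc _ cg); rewrite egh; apply: fd.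
- right; apply: (@regmod_factor _ s' t (ev x g)); rewrite mulrC egh; exact: fc.
Qed.

(** Induction on the degree. A proper factorization of f holds only up to a nonzero constant of A,
    which [factorable_dvd] removes. For irreducible f all strong primes of A are split off from
    f(x), and the rest is a unit or a strong prime. *)
Lemma factorable_ev f : f != 0 -> factorable S (ev x f).
Proof.
have [n] := ubnP (size f); elim: n f => // n IH f szf f0.
have evf0 := transc f0.
have Sev : S (ev x f) by apply: adj_ev.
have [[h [hd hsz1 hsz2]]|irr] := EM (exists h,
    [/\ dvdp h f, (1 < size h)%N & (size h < size f)%N]).
  have [[c q] /= c0 ec] := Pdiv.Idomain.dvdpP _ _ hd.
  have h0 : h != 0 by rewrite -size_poly_gt0; apply: leq_trans hsz1.
  have q0 : q != 0.
    apply: contraNneq f0 => q0; move/eqP: ec.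
    by rewrite q0 mul0r scale_poly_eq0 (negbTE c0).
  have vc0 : val c != 0 by rewrite (inj_eq val_inj _ 0).
  apply: (factorable_dvd sS (b := val c)) => //.
  - by rewrite /S; apply: adj_sub; apply: ss_valA.
  - by rewrite mulf_neq0.
  rewrite mulrC -evZ ec evM; apply: factorable_mul; apply: IH => //.
    have := congr1 (size \o polyseq) ec; rewrite /= size_scale // size_mul // => esz.
    move: szf hsz1; rewrite esz; case: (size h) => [|[|k]] //.
    by rewrite !addnS /= ltnS => + _; apply: leq_ltn_trans; rewrite leq_addr.
  exact: (leq_trans hsz2).
have [sz1|sz1] := leqP (size f) 1.
  have [c c0 ->] : exists2 c, c != 0 & f = c%:P.
    by apply/size_poly1P; rewrite eqn_leq sz1 size_poly_gt0.
  rewrite evC; have vc0 : val c != 0 by rewrite (inj_eq val_inj _ 0).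
  apply: (@factorable_ext _ A); last exact: (good_fact gA (ss_valA c) vc0).
  by split; [apply: adj_sub | apply: persist].
have irf : irreducible_poly f.
  split=> // h hsz hf; rewrite -Pdiv.Idomain.dvdp_size_eqp //.
  apply: contrapT => /negP ne; apply: irr; exists h; split=> //.
    have := Pdiv.Idomain.dvdpN0 hf f0; rewrite -size_poly_gt0.
    by case: (size h) hsz => [|[|k]].
  by rewrite ltn_neqAle ne /=; apply: Pdiv.Idomain.dvdp_leq.
have [l [s' [hl es hs']]] := pull_sprimes evf0.
have Al : A (\prod_(p <- l) p) by apply: sub_prod; [apply: ss_ring | move=> p /hl[]].
have l0 : \prod_(p <- l) p != 0 by apply: contraNneq evf0; rewrite es => ->; rewrite mul0r.
have Ss' : S s' by apply: (sS _ l0); [apply: adj_sub | rewrite -es].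
have reg p : sprime A p -> regmod p s'.
  by move=> hp; have [_ _ _ /(_ s' Ss') [/(hs' p hp)|]] := persist hp.
rewrite es; apply: factorable_mul.
  exists 1, l; rewrite unitr1 mul1r; split=> // p /hl; exact: persist.
have [/unit_dvd1 us'|nu] := EM (dvd s' 1).
  by exists s', [::]; rewrite big_nil mulr1.
exists 1, [:: s']; rewrite unitr1 big_seq1 mul1r; split=> // p.
rewrite inE => /eqP->; exact: (sprime_irred irf Ss' Al l0 (esym es) reg).
Qed.

Theorem good_adj : good S.
Proof.
split=> // s [f [g [g0 e]]] s0.
have f0 : f != 0.
  by apply: contraTneq (mulf_neq0 g0 s0) => f0; rewrite e f0 ev0 eqxx.
apply: (factorable_dvd sS (b := ev x g)).
- by exists f, g.
- exact: adj_ev.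
- by rewrite mulf_neq0.
- by rewrite mulrC e; apply: factorable_ev.
Qed.

Lemma ext_adj : ext A S.
Proof. by split; [apply: adj_sub | apply: persist]. Qed.

(** The polynomial X is irreducible with value x. This produces the strong primes inside the height
    one primes. *)
Lemma sprime_gen : ~ dvd x 1 -> (forall p, sprime A p -> regmod p x) -> sprime S x.
Proof.
move=> nu hx; apply: (@sprime_irred 'X x 1) => //.
- by rewrite -['X]addr0 -oppr0 -polyC0; apply: Pdiv.Idomain.irredp_XsubC.
- exact: adj_gen.
- exact: (sub1 (ss_ring A)).
- exact: oner_neq0.
- by rewrite mul1r evX.
Qed.

End Adjunction.

(** * Maximal associated primes of principal ideals *)

Section AssociatedPrimes.
Variable B : idomainType.
Hypothesis noethB : noetherian (@setTB B).
Implicit Types (I J P Q : B -> Prop) (a b c p s t x y : B).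

(** The generators have to lie in G itself, so each generator of the ideal is replaced by the
    finitely many elements of G that express it. *)
Lemma fin_gen (G : B -> Prop) : exists s : seq B, (forall x, x \in s -> G x) /\
  subset_ (ideal_span (@setTB B) G) (ideal_span (@setTB B) (seq_set s)).
Proof.
have hG : is_ideal (@setTB B) (ideal_span (@setTB B) G) by apply: span_ideal.
have [s0 [s0G Gs0]] := noethB hG.
suff [s [sG s0s]] : exists s : seq B, (forall x, x \in s -> G x) /\
    forall x, x \in s0 -> ideal_span (@setTB B) (seq_set s) x.
  exists s; split=> // x /Gs0; apply: span_sub => //.
  exact: span_ideal.
elim: s0 s0G {Gs0} => [|a s0 IH] s0G; first by exists [::].
have [|s [sG hs]] := IH; first by move=> x xs; apply: s0G; rewrite inE xs orbT.
have [l [hl el]] := s0G a (mem_head _ _).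
exists ([seq rp.2 | rp <- l] ++ s); split.
  by move=> x; rewrite mem_cat => /orP[/mapP[rp /hl[_ ?] ->]|/sG].
move=> x; rewrite inE => /orP[/eqP->|/hs].
  exists l; split=> // rp rpl; split; first by have [] := hl rp rpl.
  by rewrite /seq_set mem_cat; apply/orP; left; apply/mapP; exists rp.
by apply: span_mono => y; rewrite /seq_set mem_cat => ->; rewrite orbT.
Qed.

Definition colon p c : B -> Prop := fun y => dvd p (y * c).

Lemma colon_ideal p c : idealT (colon p c).
Proof.
split; first by rewrite /colon mul0r; apply: dvd0.
- by move=> x y px py; rewrite /colon mulrDl; apply: dvd_add.
- by move=> r x px; rewrite /colon -mulrA; apply: dvd_mull.
Qed.

(* The maximal colon ideals (p : c) are prime and cover the zero divisors modulo p;
   they are finitely many because the c's generate a finitely generated ideal. *)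
Lemma ass_cover p : exists L : seq B,
  (forall c, c \in L -> is_prime (@setTB B) (colon p c) /\ ~ dvd p c) /\
  (forall y, ~ regmod p y -> exists2 c, c \in L & colon p c y).
Proof.
pose mx c := ~ dvd p c /\ forall d, ~ dvd p d -> subset_ (colon p c) (colon p d) ->
  subset_ (colon p d) (colon p c).
have mx_prime c : mx c -> is_prime (@setTB B) (colon p c).
  move=> [nc cmax]; split; first exact/idealTP/colon_ideal.
  split; first by rewrite /colon mul1r.
  move=> a b _ _ pab; have [pb|npb] := EM (colon p c b); [by right | left].
  apply: (cmax (b * c)) => //; last by rewrite /colon mulrA.
  by move=> y py; rewrite /colon mulrCA; apply: dvd_mull.
have mx_ex y : ~ regmod p y -> exists c, mx c /\ colon p c y.
  move=> ny; have [c0 [nc0 yc0]] : exists c0, ~ dvd p c0 /\ colon p c0 y.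
    apply: contrapT => h; apply: ny => c0 pc0; apply: contrapT => nc0.
    by apply: h; exists c0.
  have [||Q [[c [nc yc e]] cmax]] := @noetherian_max B noethB (fun Q =>
    exists c, [/\ ~ dvd p c, colon p c y & Q = colon p c]).
  - by move=> Q [c [_ _ ->]]; apply: colon_ideal.
  - by exists (colon p c0), c0.
  exists c; split=> //; split=> // d nd cd; rewrite -e; apply: cmax.
    by exists d; split=> //; apply: cd.
  by rewrite e.
have [L [Lmx Lgen]] := fin_gen mx.
exists L; split=> [c /Lmx hc|y /mx_ex[c [hc yc]]].
  by split; [apply: mx_prime | case: hc].
(* Otherwise every (p : d) with d in L has an element outside the prime (p : c). The product z of
   these elements kills L modulo p, hence also c, although z lies outside (p : c). *)
apply: contrapT => h.
have hd d : d \in L -> exists z, colon p d z /\ ~ colon p c z.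
  move=> dL; apply: contrapT => nz; apply: h; exists d => //.
  have cd : subset_ (colon p d) (colon p c).
    by move=> z dz; apply: contrapT => ncz; apply: nz; exists z.
  have [_ dmax] := Lmx d dL.
  by apply: (dmax c) => //; case: hc.
have [_ [nc1 hcp]] := mx_prime c hc.
have [z [ncz hz]] : exists z, ~ colon p c z /\ forall d, d \in L -> colon p d z.
  elim: (L) hd => [|a s IH] hd; first by exists 1.
  have [|z [ncz hz]] := IH; first by move=> d ds; apply: hd; rewrite inE ds orbT.
  have [w [aw ncw]] := hd a (mem_head _ _).
  exists (z * w); split; first by move=> /hcp[].
  move=> d; rewrite inE => /orP[/eqP->|ds].
    by rewrite /colon -mulrA; apply: dvd_mull.
  by rewrite /colon mulrAC; apply: dvd_mulr; apply: hz.
apply: ncz; have : ideal_span (@setTB B) (seq_set L) c.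
  by apply: Lgen; apply: span_mem.
apply: (@span_sub _ _ (fun d => dvd p (z * d))); last by move=> d /hz.
apply/idealTP; split; first by rewrite mulr0; apply: dvd0.
- by move=> a b pa pb; rewrite mulrDr; apply: dvd_add.
- by move=> r a pa; rewrite mulrCA; apply: dvd_mull.
Qed.

End AssociatedPrimes.

(** * Local rings, and roots of polynomials modulo a prime *)

Section LocalRing.
Variables (B : idomainType) (M : B -> Prop).
Hypothesis locB : is_local (@setTB B) M.
Implicit Types (I J P Q : B -> Prop) (a b c p s t x y : B).

Lemma local_noeth : noetherian (@setTB B). Proof. by case: locB. Qed.

Lemma local_ideal : idealT M.
Proof. by have [_ [[/idealTP]]] := locB. Qed.

Lemma local_proper : ~ M 1.
Proof. by have [_ [[_ []]]] := locB. Qed.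

Lemma local_top I : idealT I -> ~ I 1 -> subset_ I M.
Proof.
move=> hI I1.
have [||K [[hK IK K1] Kmax]] := @noetherian_max B local_noeth (fun J =>
  [/\ idealT J, subset_ I J & ~ J 1]).
- by move=> J [].
- by exists I; split=> // x.
have [_ [_ /(_ K) KM]] := locB.
move=> x /IK; apply KM; split; first exact/idealTP.
split=> // J /idealTP hJ J1 KJ y; split; last exact: KJ.
by apply: Kmax => //; split=> // z /IK/KJ.
Qed.

Lemma prime_local P : is_prime (@setTB B) P -> subset_ P M.
Proof. by move=> [/idealTP hP [P1 _]]; apply: local_top. Qed.

Lemma local_unit b : ~ M b <-> b \is a GRing.unit.
Proof.
split=> [nMb|ub Mb]; last first.
  apply: local_proper; have [_ _ h] := local_ideal.
  by rewrite -(mulVr ub); apply: h.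
apply/unit_dvd1; apply: contrapT => n1; apply: nMb.
by apply: (local_top (I := dvd b)) => //; [apply/idealTP/principal_ideal | apply: dvd_refl].
Qed.

Lemma local_prime : is_prime (@setTB B) M.
Proof.
split; first exact/idealTP/local_ideal; split; first exact: local_proper.
move=> a b _ _ Mab; have [Ma|/local_unit ua] := EM (M a); first by left.
have [Mb|/local_unit ub] := EM (M b); first by right.
have : a * b \is a GRing.unit by rewrite unitrM ua.
by move=> /local_unit.
Qed.

End LocalRing.

Section Roots.
Variable B : idomainType.

Lemma primeT_ideal (q : B -> Prop) : is_prime (@setTB B) q -> idealT q.
Proof. by move=> [/idealTP]. Qed.

Lemma primeT_mul (q : B -> Prop) a b : is_prime (@setTB B) q -> q (a * b) -> q a \/ q b.
Proof. by move=> [_ [_ h]]; apply: h. Qed.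

Lemma ideal_sub (q : B -> Prop) a b : idealT q -> q a -> q b -> q (a - b).
Proof. by move=> [_ hD hM] qa qb; apply: hD => //; rewrite -mulN1r; apply: hM. Qed.

(** The root count over the domain B/q, carried out in B: at a root a modulo q, f - f(a) equals g (X
    - a) exactly and f(a) lies in q, so g is again nonzero modulo q and every further root is a root
    of g or congruent to a. *)
Lemma roots_mod (q : B -> Prop) (f : {poly B}) : is_prime (@setTB B) q ->
  ~ (forall i, q f`_i) -> exists l : seq B, forall z, q f.[z] -> exists2 v, v \in l & q (z - v).
Proof.
move=> qp; have [q0 qD qM] := primeT_ideal qp.
have [n] := ubnP (size f); elim: n f => // n IH f szf nf.
have [[a qa]|nr] := EM (exists a, q f.[a]); last by exists [::] => z qz; case: nr; exists z.
have szf1 : (1 < size f)%N.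
  rewrite ltnNge; apply/negP => /size1_polyC e; apply: nf => i.
  move: qa; rewrite e hornerC coefC; case: i => //= _ _; exact: q0.
have /factor_theorem[g eg] : root (f - f.[a]%:P) a.
  by rewrite /root hornerD hornerN hornerC subrr.
have ef : f = g * ('X - a%:P) + f.[a]%:P by rewrite -eg subrK.
have ng : ~ (forall i, q g`_i).
  move=> hg; apply: nf => i; rewrite ef coefD mulrBr coefB coefMX coefMC.
  apply: (qD).
    apply: (ideal_sub (primeT_ideal qp)); last by rewrite mulrC; apply: qM.
    by case: ifP.
  by rewrite coefC; case: ifP.
have g0 : g != 0 by apply/eqP => g0; apply: ng => i; rewrite g0 coef0.
have szg : (size g < n)%N.
  have := size_polyD f (- (f.[a])%:P); rewrite eg size_Mmonic ?monicXsubC //.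
  rewrite size_XsubC addn2 /= size_polyN => h.
  rewrite -ltnS; apply: (leq_trans _ szf); rewrite ltnS.
  apply: (leq_trans h); rewrite geq_max leqnn /=.
  by apply: leq_trans (size_polyC_leq1 _) _; apply: ltnW.
have [l hl] := IH g szg ng.
exists (a :: l) => z qz.
have : q (g.[z] * (z - a)).
  have -> : g.[z] * (z - a) = f.[z] - f.[a].
    by rewrite {1}ef !hornerE; ring.
  exact: (ideal_sub (primeT_ideal qp)).
move=> /(primeT_mul qp)[/hl[v vl qv]|qza]; last by exists a => //; apply: mem_head.
by exists v => //; rewrite inE vl orbT.
Qed.

End Roots.

(** * Cardinality bounds relative to an index set *)

Fixpoint Allp T (X : T -> Prop) (l : seq T) : Prop :=
  if l is x :: l' then X x /\ Allp X l' else True.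

Lemma AllpP (T : eqType) (X : T -> Prop) (l : seq T) :
  Allp X l <-> forall x, x \in l -> X x.
Proof.
elim: l => [|a l IH] //=; split=> [[Xa /IH h] x|h].
  by rewrite inE => /orP[/eqP->|/h].
split; first by apply/h/mem_head.
by apply/IH => x xl; apply: h; rewrite inE xl orbT.
Qed.

Section Size.
Variables (J : Type) (dec : J -> seq J).

Definition code_closed (D : J -> Prop) :=
  forall l, Allp D l -> exists j, D j /\ dec j = l.

Variable D : J -> Prop.

(* [sz X]: the set [X] is a partial image of [D]; closure of [D] under coding of
   finite sequences replaces cardinal arithmetic. *)
Definition sz T (X : T -> Prop) :=
  exists F : J -> option T, forall t, X t -> exists j, D j /\ F j = Some t.

Lemma sz_sub T (X Y : T -> Prop) : (forall t, X t -> Y t) -> sz Y -> sz X.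
Proof. by move=> h [F hF]; exists F => t /h /hF. Qed.

Lemma sz_img T U (X : T -> Prop) (h : T -> U) : sz X -> sz (fun u => exists t, X t /\ u = h t).
Proof.
move=> [F hF]; exists (fun j => omap h (F j)) => u [t [Xt ->]].
by have [j [Dj e]] := hF t Xt; exists j; rewrite e.
Qed.

Hypothesis cD : code_closed D.

Lemma code_nil : exists j, D j. Proof. by have [j []] := @cD [::] I; exists j. Qed.

Lemma sz_list T (X : T -> Prop) : sz X -> sz (Allp X).
Proof.
move=> [F hF]; exists (fun j => Some (pmap F (dec j))) => l Xl.
suff [k [Dk e]] : exists k, Allp D k /\ pmap F k = l.
  by have [j [Dj ej]] := cD Dk; exists j; rewrite ej e.
elim: l Xl => [|t l IH] /=; first by exists [::].
move=> [/hF[j [Dj e]] /IH[k [Dk ek]]]; exists (j :: k) => /=.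
by rewrite e /= ek.
Qed.

Lemma sz_nat : sz (fun _ : nat => True).
Proof.
have [j0 D0] := code_nil.
exists (fun j => Some (size (dec j))) => n _.
have [|j [Dj e]] := @cD (nseq n j0); first by elim: n => //= n IH.
by exists j; rewrite e size_nseq.
Qed.

Lemma sz_count (T : countType) (X : T -> Prop) : sz X.
Proof.
have [F hF] := sz_nat.
exists (fun j => obind unpickle (F j)) => t _.
by have [j [Dj e]] := hF (pickle t) I; exists j; rewrite e /= pickleK.
Qed.

Lemma sz_sigma T U (X : T -> Prop) (Y : T -> U -> Prop) : sz X ->
  (forall t, X t -> sz (Y t)) -> sz (fun p : T * U => X p.1 /\ Y p.1 p.2).
Proof.
move=> [F hF] hY.
have /choice[G hG] t : exists G : J -> option U, X t ->
    forall u, Y t u -> exists j, D j /\ G j = Some u.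
  by have [Xt|nX] := EM (X t); [have [G hG] := hY t Xt; exists G | exists (fun=> None)].
exists (fun j => if dec j is [:: j1; j2] then
   obind (fun t => omap (pair t) (G t j2)) (F j1) else None).
move=> [t u] /= [Xt Yu]; have [j1 [D1 e1]] := hF t Xt.
have [j2 [D2 e2]] := hG t Xt u Yu.
have [|j [Dj e]] := @cD [:: j1; j2]; first by [].
by exists j; rewrite e e1 /= e2.
Qed.

Lemma sz_bigcup T U (X : T -> Prop) (Y : T -> U -> Prop) : sz X ->
  (forall t, X t -> sz (Y t)) -> sz (fun u => exists t, X t /\ Y t u).
Proof.
move=> sX sY; apply: sz_sub (sz_img snd (sz_sigma sX sY)) => u [t [Xt Yu]].
by exists (t, u).
Qed.

Lemma sz_mem (T : eqType) (s : seq T) : sz (fun x => x \in s).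
Proof.
case: s => [|a s]; first by exists (fun=> None) => t; rewrite in_nil.
apply: sz_sub (sz_img (nth a (a :: s)) sz_nat) => x xs.
by exists (index x (a :: s)); rewrite nth_index.
Qed.

Lemma sz_union T (X Y : T -> Prop) : sz X -> sz Y -> sz (fun t => X t \/ Y t).
Proof.
move=> sX sY; apply: (@sz_sub _ _ (fun t => exists b : bool, True /\ if b then X t else Y t)).
  by move=> t [h|h]; [exists true | exists false].
by apply: sz_bigcup; [apply: sz_count | case].
Qed.

End Size.

(** * Generic choices when few residue classes are forbidden *)

Section Generic.
Variables (J : Type) (dec : J -> seq J) (D : J -> Prop).
Hypothesis cD : code_closed dec D.
Variables (B : idomainType) (M : B -> Prop).
Hypothesis locB : is_local (@setTB B) M.
Hypothesis smallD : forall X : B -> Prop, sz D X -> (forall b, exists x, X x /\ M (b - x)) -> False.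

(** Each condition forbids finitely many classes modulo M, so together they forbid a set of classes
    of size D, which cannot exhaust B/M. *)
Lemma avoid T (X : T -> Prop) (bad : T -> B -> Prop) : sz D X ->
  (forall t, X t -> exists l : seq B, forall u, bad t u -> exists2 v, v \in l & M (u - v)) ->
  exists u, forall t, X t -> ~ bad t u.
Proof.
move=> sX h; apply: contrapT => no.
have /choice[L hL] t : exists l : seq B, X t ->
    forall u, bad t u -> exists2 v, v \in l & M (u - v).
  by have [Xt|nX] := EM (X t); [have [l hl] := h t Xt; exists l | exists [::]].
apply: (@smallD (fun v => exists t, X t /\ v \in L t)).
  by apply: (sz_bigcup cD) => // t _; apply: (sz_mem cD).
move=> u; apply: contrapT => nu; apply: no; exists u => t Xt bu.
by have [v vL Mv] := hL t Xt u bu; apply: nu; exists v; split=> //; exists t.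
Qed.

(** Prime avoidance for families of size D. The polynomial with coefficients s is nonzero modulo
    each q, so its roots fill finitely many classes modulo q, hence modulo M. *)
Lemma generic_combination (Q : (B -> Prop) -> Prop) (s : seq B) : sz D Q ->
  (forall q, Q q -> is_prime (@setTB B) q) ->
  (forall q, Q q -> exists2 y, y \in s & ~ q y) ->
  exists u, forall q, Q q -> ~ q (Poly s).[u].
Proof.
move=> sQ pQ hQ; apply: avoid => // q Qq.
have [y ys nqy] := hQ q Qq.
have [|l hl] := @roots_mod B q (Poly s) (pQ q Qq).
  by move=> /(_ (index y s)); rewrite coef_Poly nth_index.
exists l => u /hl[v vl qv]; exists v => //.
exact: (prime_local locB (pQ q Qq)).
Qed.

Lemma sz_poly (A : satsub B) : sz D A -> sz D (fun _ : {poly ss_type A} => True).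
Proof.
move=> sA; pose h (l : seq B) : {poly ss_type A} := Poly [seq insubd 0 b | b <- l].
apply: sz_sub (sz_img h (sz_list cD sA)) => f _.
exists [seq val c | c <- f]; split.
  by apply/AllpP => x /mapP[c _ ->]; apply: ss_valA.
rewrite /h -map_comp (eq_map (g := id)) ?map_id ?polyseqK //.
by move=> c /=; rewrite valKd.
Qed.

(** As B is a domain, an element is determined by its numerator and denominator, so pairs of
    polynomials index the new ring. *)
Lemma sz_adj (A : satsub B) x : sz D A -> sz D (adj A x).
Proof.
move=> sA; have sP := sz_poly sA.
apply: (@sz_sub _ D B _ (fun b => exists f : {poly ss_type A}, True /\
    exists g : {poly ss_type A}, True /\ (ev x g != 0 /\ ev x g * b = ev x f))).
  by move=> b [f [g h]]; exists f; split=> //; exists g.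
apply: (sz_bigcup cD) => // f _; apply: (sz_bigcup cD) => // g _.
exists (fun j => if pselect (exists b, ev x g != 0 /\ ev x g * b = ev x f) is left e
  then Some (sval (cid e)) else None) => b [g0 e].
have [j Dj] := code_nil cD; exists j; split=> //.
case: pselect => [e'|[]]; last by exists b.
case: cid => b' [_ eb'] /=; congr Some; apply: (mulfI g0).
by rewrite eb' e.
Qed.

(** A forbidden value of al + be m lies in one of finitely many classes modulo q, and since be is
    outside the prime q, each such class determines m modulo q. *)
Lemma generic_element (A : satsub B) (F : (B -> Prop) * (B * B) -> Prop) :
  sz D A -> sz D F ->
  (forall q al be, F (q, (al, be)) -> is_prime (@setTB B) q /\ ~ q be) ->
  exists m, forall q al be, F (q, (al, be)) -> forall f : {poly ss_type A},
    ~ (forall i, q (val f`_i)) -> ~ q (ev (al + be * m) f).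
Proof.
move=> sA sF hF.
pose bad (t : ((B -> Prop) * (B * B)) * {poly ss_type A}) m :=
  let: (q, (al, be), f) := t in
  ~ (forall i, q (val f`_i)) /\ q (ev (al + be * m) f).
have [||m hm] := @avoid _ (fun t => F t.1 /\ True) bad.
- by apply: (sz_sigma cD (Y := fun _ (_ : {poly ss_type A}) => True)) => // t _; apply: sz_poly.
- move=> [[q [al be]] f] [/= /hF[qp nqb] _].
  have [nf|hf] := EM (~ (forall i, q (val f`_i))); last by exists [::] => m [].
  have [|l hl] := @roots_mod B q (map_poly val f) qp.
    by move=> h; apply: nf => i; have := h i; rewrite coef_map.
  (* w z is some solution of al + be u = z modulo q, and 0 when there is none. *)
  have /choice[w hw] z : exists w, (exists u, q (al + be * u - z)) -> q (al + be * w - z).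
    by have [[u hu]|nu] := EM (exists u, q (al + be * u - z)); [exists u | exists 0].
  exists [seq w z | z <- l] => u [_ qu].
  have [z zl qz] := hl _ qu.
  exists (w z); first by apply/mapP; exists z.
  apply: (prime_local locB qp).
  have /(hw z) qw : exists u, q (al + be * u - z) by exists u.
  have := ideal_sub (primeT_ideal qp) qz qw.
  have -> : al + be * u - z - (al + be * w z - z) = be * (u - w z) by ring.
  by move=> /(primeT_mul qp)[].
- exists m => q al be Fq f nf qf.
  by apply: (hm ((q, (al, be)), f)).
Qed.

End Generic.

(** * Spans of finite lists over a subring *)

Section Span.
Variables (B : idomainType) (R : B -> Prop).
Hypothesis hR : is_subring R.
Implicit Types (G : B -> Prop) (l : seq B) (x y z a g : B).

Lemma span0 G : ideal_span R G 0.
Proof. by exists [::]; rewrite big_nil. Qed.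

Lemma spanD G x y : ideal_span R G x -> ideal_span R G y -> ideal_span R G (x + y).
Proof.
move=> [l [hl ->]] [k [hk ->]]; exists (l ++ k); rewrite big_cat; split=> // rp.
by rewrite mem_cat => /orP[/hl|/hk].
Qed.

Lemma spanM G r x : R r -> ideal_span R G x -> ideal_span R G (r * x).
Proof.
move=> Rr [l [hl ->]]; exists [seq (r * q.1, q.2) | q <- l]; split.
  by move=> rp /mapP[q /hl[Rq Gq] ->]; split=> //; apply: subM.
by rewrite big_map mulr_sumr; apply: eq_bigr => q _; rewrite mulrA.
Qed.

Lemma span_ind G (P : B -> Prop) : P 0 ->
  (forall x y, P x -> P y -> P (x + y)) -> (forall r x, R r -> G x -> P (r * x)) ->
  subset_ (ideal_span R G) P.
Proof.
move=> P0 PD PM x [l [hl ->]]; elim: l hl => [|rp l IH] hl; first by rewrite big_nil.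
rewrite big_cons; apply: PD; first by have [? ?] := hl rp (mem_head _ _); apply: PM.
by apply: IH => q ql; apply: hl; rewrite inE ql orbT.
Qed.

Lemma span_cons a l z : ideal_span R (seq_set (a :: l)) z <->
  exists t y, [/\ R t, ideal_span R (seq_set l) y & z = t * a + y].
Proof.
split=> [|[t [y [Rt ly ->]]]].
  move: z; apply: span_ind.
  - by exists 0, 0; rewrite mul0r addr0; split=> //; [apply: sub0 | apply: span0].
  - move=> _ _ [t [y [Rt ly ->]]] [t' [y' [Rt' ly' ->]]]; exists (t + t'), (y + y').
    by split; [apply: subD | apply: spanD | ring].
  - move=> r x Rr; rewrite /seq_set inE => /orP[/eqP->|xl].
      by exists r, 0; rewrite addr0; split=> //; apply: span0.
    exists 0, (r * x); rewrite mul0r add0r; split=> //; first exact: sub0.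
    by apply: spanM => //; apply: span_mem => //; apply: sub1.
apply: spanD; first by apply: spanM => //; apply: span_mem; [apply: sub1 | apply: mem_head].
by apply: span_mono ly => x; rewrite /seq_set inE => ->; rewrite orbT.
Qed.

Lemma span_scale g l z : ideal_span R (seq_set [seq g * a | a <- l]) z <->
  exists y, ideal_span R (seq_set l) y /\ z = g * y.
Proof.
split=> [|[y [ly ->]]].
  move: z; apply: span_ind.
  - by exists 0; rewrite mulr0; split=> //; apply: span0.
  - move=> _ _ [y [ly ->]] [y' [ly' ->]]; exists (y + y').
    by rewrite mulrDr; split=> //; apply: spanD.
  - move=> r x Rr /mapP[a al ->]; exists (r * a); split; last by ring.
    by apply: spanM => //; apply: span_mem => //; apply: sub1.
move: y ly; apply: span_ind; first by rewrite mulr0; apply: span0.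
- by move=> x y hx hy; rewrite mulrDr; apply: spanD.
- move=> r x Rr xl; rewrite mulrCA; apply: spanM => //; apply: span_mem; first exact: sub1.
  by apply/mapP; exists x.
Qed.

End Span.

(** * Single extension steps: residues, generators of primes, linear equations *)

Lemma sprime_same (B : idomainType) (R S : B -> Prop) p :
  same_ R S -> sprime R p -> sprime S p.
Proof. by move=> e [Rp p0 np h]; split=> //; [apply/e | move=> s /e/h]. Qed.

Definition deep (B : idomainType) (P : B -> Prop) :=
  forall b q, ass_quot b q -> ~ subset_ P q.

Lemma ass_colon (B : idomainType) (p c : B) :
  is_prime (@setTB B) (colon p c) -> ass_quot p (colon p c).
Proof. by move=> hp; split=> //; exists c => y; split. Qed.

Lemma zero_prime (B : idomainType) : is_prime (@setTB B) (fun x => x = 0).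
Proof.
split; first apply/idealTP; split=> //.
- by move=> x y -> ->; rewrite addr0.
- by move=> r x ->; rewrite mulr0.
- by move=> /eqP; rewrite oner_eq0.
- by move=> a b _ _ /eqP; rewrite mulf_eq0 => /orP[]/eqP; [left|right].
Qed.

Section Steps.
Variables (J : Type) (dec : J -> seq J) (D : J -> Prop).
Hypothesis cD : code_closed dec D.
Variables (B : idomainType) (M : B -> Prop).
Hypothesis locB : is_local (@setTB B) M.
Hypothesis smallD : forall X : B -> Prop, sz D X -> (forall b, exists x, X x /\ M (b - x)) -> False.
Let noethB := local_noeth locB.
Implicit Types (A S : satsub B) (P : B -> Prop).

Definition extends A S := [/\ good S, ext A S & sz D S].

Lemma extends_trans A S S' : ext A S -> extends S S' -> extends A S'.
Proof. by move=> h [h1 h2 h3]; split=> //; apply: ext_trans h2. Qed.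

Lemma assoc_primes : exists L : B -> seq B, forall p,
  (forall c, c \in L p -> is_prime (@setTB B) (colon p c) /\ ~ dvd p c) /\
  (forall y, ~ regmod p y -> exists2 c, c \in L p & colon p c y).
Proof. by have /choice[L hL] := ass_cover noethB; exists L. Qed.

(** The zero ideal, the primes in Ex and the maximal associated primes of all strong primes of A
    form a family of size D, and none of them contains I. A generic combination of finitely many
    generators of I avoids them all. *)
Lemma regular_element A (I : B -> Prop) (Ex : (B -> Prop) -> Prop) :
  sz D A -> sz D Ex -> idealT I ->
  (forall p c, sprime A p -> is_prime (@setTB B) (colon p c) -> ~ dvd p c ->
     ~ subset_ I (colon p c)) ->
  (forall q, Ex q -> is_prime (@setTB B) q /\ ~ subset_ I q) ->
  ~ subset_ I (fun x => x = 0) ->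
  exists s, [/\ I s, s != 0, forall p, sprime A p -> regmod p s & forall q, Ex q -> ~ q s].
Proof.
move=> sA sEx hI hp hEx I0; have [L hL] := assoc_primes.
have [ys [ysI Iys]] := noethB (proj2 (idealTP I) hI).
pose Q q := q = (fun x : B => x = 0) \/ Ex q \/
  exists p, sprime A p /\ exists c, c \in L p /\ q = colon p c.
have sQ : sz D Q.
  apply: (sz_union cD); last apply: (sz_union cD) => //.
    have [j Dj] := code_nil cD.
    by exists (fun=> Some (fun x : B => x = 0)) => q ->; exists j.
  apply: (sz_bigcup cD); first by apply: sz_sub sA => p [].
  by move=> p _; apply: sz_img; apply: (sz_mem cD).
have QI q : Q q -> is_prime (@setTB B) q /\ ~ subset_ I q.
  move=> [->|[/hEx//|[p [sp [c [cL ->]]]]]]; first by split=> //; apply: zero_prime.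
  by have [/(_ c cL)[h1 h2] _] := hL p; split=> //; apply: hp.
have [||u hu] := @generic_combination J dec D cD B M locB smallD Q ys sQ.
- by move=> q /QI[].
- move=> q /QI[qp nIq]; apply: contrapT => no; apply: nIq => x /Iys.
  apply: span_sub; first by apply/idealTP/primeT_ideal.
  by move=> y yys; apply: contrapT => nqy; apply: no; exists y.
exists (Poly ys).[u]; split.
- have [I0' ID IM] := hI; rewrite horner_Poly; elim: (ys) ysI => //= a s IH sI.
  apply: (ID); last by apply: sI; apply: mem_head.
  by rewrite mulrC; apply/IM/IH => x xs; apply: sI; rewrite inE xs orbT.
- by apply/eqP => e; apply: (hu _ (or_introl erefl)).
- move=> p sp; apply: contrapT => nr; have [hc] := hL p => /(_ _ nr)[c cL].
  by apply: hu; right; right; exists p; split=> //; exists c.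
- by move=> q Eq; apply: hu; right; left.
Qed.

Lemma deep_element A P : sz D A -> idealT P -> deep P ->
  exists s, [/\ P s, s != 0 & forall p, sprime A p -> regmod p s].
Proof.
move=> sA hP dP.
have [||||s [h1 h2 h3 _]] := @regular_element A P (fun=> False) sA _ hP.
- by exists (fun=> None).
- by move=> p c _ hpc _; apply: dP; apply: ass_colon hpc.
- by [].
(* The zero ideal is associated to 0, as the annihilator of 1, so a deep ideal is nonzero. *)
- apply: (dP 0); split; first exact: zero_prime.
  by exists 1 => y; rewrite mulr1; split=> [->|[a ->]]; [exists 0|]; rewrite mul0r.
by exists s.
Qed.

(** Two coordinates driven by the same m generate the same ring over A, as each lies in every
    saturated extension containing the other. For each strong prime p one of the slopes [be1], [be2]
    is regular modulo p; the corresponding coordinate is made generic modulo p, so p persists. *)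
Lemma adjoin A al1 be1 al2 be2 (Ex : (B -> Prop) -> Prop) :
  good A -> sz D A -> be1 != 0 -> sz D Ex ->
  (forall q, Ex q -> is_prime (@setTB B) q /\ ~ q be1) ->
  (forall m S, subset_ A S -> S (al1 + be1 * m) <-> S (al2 + be2 * m)) ->
  (forall p, sprime A p -> regmod p be1 \/ regmod p be2) ->
  exists m S, let x := al1 + be1 * m in
   [/\ extends A S, S = adj A x :> (B -> Prop),
    S (al2 + be2 * m), forall f : {poly ss_type A}, f != 0 -> ev x f != 0 &
   (forall p, sprime A p -> regmod p be1 -> generic A p x) /\
   (forall q, Ex q -> forall f : {poly ss_type A}, ~ (forall i, q (val f`_i)) -> ~ q (ev x f))].
Proof.
move=> gA sA be10 sEx hEx sym hp; have [L hL] := assoc_primes.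
(* The zero ideal gives transcendence, Ex the additional avoidance, and the primes (p : c)
   persistence of p; the boolean selects the coordinate used for p. *)
pose F (t : (B -> Prop) * (B * B)) :=
  (exists q, (q = (fun x : B => x = 0) \/ Ex q) /\ t = (q, (al1, be1))) \/
  exists p, sprime A p /\ exists c, c \in L p /\
    (exists be, (if be then regmod p be1 else regmod p be2) /\
     t = (colon p c, if be then (al1, be1) else (al2, be2))).
have [||m hm] := @generic_element J dec D cD B M locB smallD A F sA.
- apply: (sz_union cD).
    apply: sz_img; apply: (sz_union cD) => //.
    have [j Dj] := code_nil cD.
    by exists (fun=> Some (fun x : B => x = 0)) => q ->; exists j.
  apply: (sz_bigcup cD); first by apply: sz_sub sA => p [].
  move=> p _; apply: (sz_bigcup cD); first exact: (sz_mem cD).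
  move=> c _.
  apply: (sz_sub _ (sz_img (fun be : bool =>
    (colon p c, if be then (al1, be1) else (al2, be2))) (sz_count cD (fun=> True)))).
  by move=> t [be [_ ->]]; exists be.
- move=> q al be [[q' [h [-> _ ->]]]|[p [sp [c [cL [b [hb]]]]]]].
    by case: h => [->|/hEx//]; split; [apply: zero_prime | apply/eqP].
  have [/(_ c cL)[qp nc] _] := hL p.
  by case: b hb => rb [-> _ ->]; split=> // /rb.
have hgen al be p b : sprime A p -> (if b then regmod p be1 else regmod p be2) ->
    (al, be) = (if b then (al1, be1) else (al2, be2)) -> generic A p (al + be * m).
  move=> sp rb e f nf; apply: contrapT => nr.
  have [hc] := hL p => /(_ _ nr)[c cL]; have [_ nc] := hc c cL.
  apply: (hm (colon p c) al be).
    by right; exists p; split=> //; exists c; split=> //; exists b; rewrite e.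
  move=> fc; apply: nf => i; have [_ _ _ /(_ _ (ss_valA f`_i))[//|ri]] := sp.
  by have := ri _ (fc i).
pose x := al1 + be1 * m; pose y := al2 + be2 * m.
pose S := SatSub (@adj_ring B A x) (@adj_sat _ A x).
pose S' := SatSub (@adj_ring B A y) (@adj_sat _ A y).
have Sy : S y by apply/sym; [apply: adj_sub | apply: adj_gen].
have S'x : S' x by apply/sym; [apply: adj_sub | apply: adj_gen].
have eSS : same_ S' S.
  move=> b; split; apply: adj_min => //; try exact: adj_sub.
  - exact: (ss_ring S).
  - exact: (ss_sat (s := S)).
  - exact: (ss_ring S').
  - exact: (ss_sat (s := S')).
have transc (f : {poly ss_type A}) : f != 0 -> ev x f != 0.
  move=> f0; apply/eqP => e; apply: (hm (fun z => z = 0) al1 be1) e.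
    by left; exists (fun z => z = 0); split=> //; left.
  move=> h; move/eqP: f0; apply; apply/polyP => i; rewrite coef0.
  by apply: val_inj; rewrite h.
have gen1 p : sprime A p -> regmod p be1 -> generic A p x.
  by move=> sp r; apply: (hgen _ _ _ true).
have persist p : sprime A p -> sprime (adj A x) p.
  move=> sp; have [r|r] := hp p sp.
    exact: sprime_adj (gen1 p sp r).
  apply: (sprime_same eSS); apply: sprime_adj => //.
  exact: (hgen _ _ _ false).
exists m, S; split=> //; last split=> //.
  by split; [apply: good_adj | apply: ext_adj | apply: (sz_adj cD)].
by move=> q Eq; apply: hm; left; exists q; split=> //; right.
Qed.

Lemma adjoin_simple A al be : good A -> sz D A -> be != 0 ->
  (forall p, sprime A p -> regmod p be) ->
  exists m S, extends A S /\ S (al + be * m).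
Proof.
move=> gA sA be0 hp.
have [||||m [S [h1 _ h2 _ _]]] := @adjoin A al be al be (fun=> False) gA sA be0.
- by exists (fun=> None).
- by [].
- by [].
- by move=> p /hp; left.
by exists m, S.
Qed.

Lemma step_residue A b : deep M -> good A -> sz D A ->
  exists S, extends A S /\ exists a, S a /\ M (b - a).
Proof.
move=> dM gA sA; have [s [Ms s0 hs]] := deep_element sA (local_ideal locB) dM.
have [m [S [eS Sx]]] := adjoin_simple b gA sA s0 hs.
exists S; split=> //; exists (b + s * m); split=> //.
have [_ _ h] := local_ideal locB.
by rewrite opprD addrA subrr sub0r -mulrN mulrC; apply: h.
Qed.

(** Let K be maximal among the ideals between N and P that do not contain P. If c z were outside K,
    then K + (c z) would contain P, so z = k + r c z; as 1 - r c is a unit, z would lie in K. Hence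
    K contains M P and N, and with them all generators of P. *)
Lemma nakayama P (N : B -> Prop) (ys : seq B) : idealT P -> idealT N ->
  subset_ N P -> same_ P (ideal_span (@setTB B) (seq_set ys)) ->
  (forall y, y \in ys -> exists n c z, [/\ N n, M c, P z & y = n + c * z]) ->
  subset_ P N.
Proof.
move=> hP hN NP Pys hys; apply: contrapT => PN.
have [||K [[hK NK KP PK] Kmax]] := @noetherian_max B noethB (fun K =>
  [/\ idealT K, subset_ N K, subset_ K P & ~ subset_ P K]).
- by move=> K [].
- by exists N; split=> // x.
have [K0 KD KM] := hK; have [P0 PD PM] := hP.
have MP c z : M c -> P z -> K (c * z).
  move=> Mc Pz; apply: contrapT => nK.
  pose K' x := exists k r, K k /\ x = k + r * (c * z).
  have PK' : subset_ P K'.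
    apply: contrapT => PK'; apply: nK; apply: (Kmax K'); last first.
    - by exists 0, 1; rewrite mul1r add0r.
    - by move=> x Kx; exists x, 0; rewrite mul0r addr0.
    split=> //.
    - split; first by exists 0, 0; rewrite mul0r addr0.
      + move=> _ _ [k [r [Kk ->]]] [k' [r' [Kk' ->]]].
        by exists (k + k'), (r + r'); split; [apply: KD | ring].
      + by move=> t _ [k [r [Kk ->]]]; exists (t * k), (t * r); split; [apply: KM | ring].
    - by move=> x /NK Kx; exists x, 0; rewrite mul0r addr0.
    - by move=> _ [k [r [/KP Pk ->]]]; apply: PD => //; apply/PM/PM.
  have [k [r [Kk ez]]] := PK' z Pz.
  have u : 1 - r * c \is a GRing.unit.
    apply/(local_unit locB) => h; apply: (local_proper locB).
    have [_ MD MM] := local_ideal locB.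
    by rewrite -(subrK (r * c) 1); apply: MD => //; apply: MM.
  apply: nK; apply: (KM).
  have -> : z = (1 - r * c)^-1 * k.
    by apply: (mulrI u); rewrite mulVKr // mulrBl mul1r {1}ez; ring.
  exact: KM.
apply: PK => x /Pys; apply: span_sub; first exact/idealTP.
move=> y /hys[n [c [z [Nn Mc Pz ->]]]].
by apply: KD; [apply: NK | apply: MP].
Qed.

Lemma step_prime A P : deep M -> deep P -> is_prime (@setTB B) P -> good A -> sz D A ->
  exists S, extends A S /\ same_ P (ideal_span (@setTB B) (fun b => S b /\ P b)).
Proof.
move=> dM dP pP gA sA; have hP := primeT_ideal pP; have [P0 PD PM] := hP.
have [ys [ysP Pys]] := noethB (proj2 (idealTP P) hP).
suff [S [eS hS]] : exists S, extends A S /\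
    forall y, y \in ys -> exists n c z, [/\ S n /\ P n, M c, P z & y = n + c * z].
  exists S; split=> //; have PN := @nakayama P (ideal_span (@setTB B) (fun b => S b /\ P b)) ys.
  have NP : subset_ (ideal_span (@setTB B) (fun b => S b /\ P b)) P.
    by apply: span_sub; [apply/idealTP | move=> x []].
  move=> x; split; last exact: NP.
  apply: PN => //; first by apply/idealTP/span_ideal.
  move=> y /hS[n [c [z [Sn Mc Pz ->]]]]; exists n, c, z; split=> //.
  exact: span_mem.
elim: ys ysP {Pys} => [|y ys IH] ysP.
  by exists A; split=> //; split=> //; apply: ext_refl.
have [|S [eS hS]] := IH; first by move=> x xs; apply: ysP; rewrite inE xs orbT.
have [gS _ sS] := eS.
have [s [Ms s0 hs]] := deep_element sS (local_ideal locB) dM.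
have [t [Pt t0 ht]] := deep_element sS hP dP.
have [m [S' [eS' S'x]]] : exists m S', extends S S' /\ S' (y + s * t * m).
  apply: adjoin_simple => //; first by rewrite mulf_neq0.
  by move=> p sp; apply: regmod_mul; [apply: hs | apply: ht].
have [_ eAS _] := eS; have [_ [SS' _] _] := eS'.
exists S'; split; first exact: extends_trans eS'.
move=> z; rewrite inE => /orP[/eqP->|/hS[n [c [w [[Sn Pn] Mc Pw ->]]]]]; last first.
  by exists n, c, w; split=> //; split=> //; apply: SS'.
exists (y + s * t * m), s, (- (m * t)); split=> //; last by ring.
  split=> //; apply: PD; first by apply: ysP; apply: mem_head.
  by rewrite mulrC; apply/PM/PM.
by rewrite -mulNr; apply: PM.
Qed.

(** A strong prime dividing all entries is divided out as long as there is one; a chosen nonzero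
    entry becomes a proper divisor each time, so this stops. *)
Lemma gcd_seq A (l : seq B) : good A -> (forall a, a \in l -> A a) ->
  (exists2 a, a \in l & a != 0) ->
  exists g l', [/\ A g, g != 0, forall a, a \in l' -> A a, l = [seq g * a | a <- l'] &
    forall p, sprime A p -> exists2 b, b \in l' & ~ dvd p b].
Proof.
move=> gA lA [a al a0]; move: a l al a0 lA.
apply: (dvd_acc_ind noethB) => a IH l al a0 lA.
have [[p [sp hp]]|no] := EM (exists p, sprime A p /\ forall b, b \in l -> dvd p b); last first.
  exists 1, l; split=> //; first exact: (sub1 (good_ring gA)).
  - exact: oner_neq0.
  - by rewrite (eq_map (g := id)) ?map_id // => x; rewrite mul1r.
  - move=> p sp; apply: contrapT => h; apply: no; exists p; split=> // b bl.
    by apply: contrapT => nb; apply: h; exists b.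
have [Ap p0 np1 _] := sp.
have [l1 [l1A el]] : exists l1, (forall a, a \in l1 -> A a) /\ l = [seq p * a | a <- l1].
  elim: (l) lA hp => [|b s IHs] sA hp; first by exists [::].
  have [||s1 [s1A ->]] := IHs.
  - by move=> x xs; apply: sA; rewrite inE xs orbT.
  - by move=> x xs; apply: hp; rewrite inE xs orbT.
  have [b1 eb] := hp b (mem_head _ _).
  exists (b1 :: s1); split; last by rewrite /= eb.
  move=> x; rewrite inE => /orP[/eqP->|/s1A //].
  by apply: (good_sat gA Ap p0); rewrite -eb; apply/sA/mem_head.
have [a1 a1l ea] : exists2 a1, a1 \in l1 & a = p * a1 by apply/mapP; rewrite -el.
have a10 : a1 != 0 by apply: contraNneq a0; rewrite ea => ->; rewrite mulr0.
have [||g [l' [Ag g0 l'A el1 hg]]] := IH a1 _ _ l1 a1l a10 l1A.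
- by rewrite ea; exists p; rewrite mulrC.
- rewrite ea => -[d ed]; apply: np1; exists d.
  by apply: (mulfI a10); rewrite mulr1 [LHS]ed; ring.
exists (p * g), l'; split=> //.
- exact: (subM (good_ring gA)).
- by rewrite mulf_neq0.
- by rewrite el el1 -map_comp; apply: eq_map => x /=; rewrite mulrA.
Qed.

(* Splitting off the first generator leaves the equation a1 x2 + g1 x1 = c' with
   a1, g1 coprime; its solutions are moved along (a1 s, - g1 s), and for every prime p
   of A at least one of the two coordinates becomes generic modulo p. *)
Lemma step_ideal A (l : seq B) c : good A -> sz D A -> (forall a, a \in l -> A a) ->
  A c -> ideal_span (@setTB B) (seq_set l) c ->
  exists S, extends A S /\ ideal_span S (seq_set l) c.
Proof.
have [n] := ubnP (size l); elim: n l A c => // n IH [|a l] A c szl gA sA lA Ac hc.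
  exists A; split; first by split=> //; apply: ext_refl.
  by move: c hc {Ac}; apply: span_ind; [apply: span0 | apply: spanD |].
have [t0 [z [_ hz ec]]] := proj1 (span_cons (setTB_ring B) a l c) hc.
have Aa : A a by apply/lA/mem_head.
have lA' b : b \in l -> A b by move=> bl; apply: lA; rewrite inE bl orbT.
have hAs := good_sat gA; have hAr := good_ring gA.
(* If all remaining generators vanish, then c = t0 a, and for nonzero a saturation puts t0 into
   A. *)
have [[b bl b0]|l0] := EM (exists2 b, b \in l & b != 0); last first.
  have z0 : z = 0.
    move: z hz {ec}; apply: span_ind => //; first by move=> x y -> ->; rewrite addr0.
    move=> r x _ xl; apply/eqP; rewrite mulf_eq0; apply/orP; right.
    by apply: contrapT => /negP x0; apply: l0; exists x.
  exists A; split; first by split=> //; apply: ext_refl.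
  apply/(span_cons hAr); have [a0|a0] := eqVneq a 0.
    by exists 0, 0; split; [apply: (sub0 hAr) | apply: span0 | rewrite ec a0 z0; ring].
  exists t0, 0; split; [|exact: span0|by rewrite ec z0].
  by apply: (hAs _ a) => //; rewrite mulrC; move: Ac; rewrite ec z0 addr0.
have [|g [l' [Ag g0 l'A el hl']]] := gcd_seq gA lA'; first by exists b.
have szl' : (size l' < n)%N by move: szl; rewrite el /= size_map.
have [y [hy ez]] : exists y, ideal_span (@setTB B) (seq_set l') y /\ z = g * y.
  by apply/(span_scale (setTB_ring B)); rewrite -el.
have [a0|a0] := eqVneq a 0.
  have Ay : A y by apply: (hAs _ g) => //; move: Ac; rewrite ec a0 mulr0 add0r ez.
  have [S [eS hS]] := IH l' A y szl' gA sA l'A Ay hy.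
  have [gS _ _] := eS; have hSr := good_ring gS.
  exists S; split=> //; apply/(span_cons hSr).
  exists 0, z; split; [exact: (sub0 hSr) | | by rewrite ec a0; ring].
  by rewrite el; apply/(span_scale hSr); exists y.
have [||d [l2 [Ad d0 l2A el2 hl2]]] := @gcd_seq A [:: a; g] gA.
- by move=> x; rewrite !inE => /orP[]/eqP->.
- by exists a => //; rewrite inE eqxx.
case: l2 el2 l2A hl2 => [|a1 [|g1 [|]]] //= [ea eg] l2A hl2.
have Aa1 : A a1 by apply: l2A; rewrite inE eqxx.
have Ag1 : A g1 by apply: l2A; rewrite !inE eqxx orbT.
have a10 : a1 != 0 by apply: contraNneq a0; rewrite ea => ->; rewrite mulr0.
have g10 : g1 != 0 by apply: contraNneq g0; rewrite eg => ->; rewrite mulr0.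
pose c' := a1 * t0 + g1 * y.
have ecd : c = d * c' by rewrite ec ez ea eg /c'; ring.
have Ac' : A c' by apply: (hAs _ d) => //; rewrite -ecd.
(* s is taken in the ideal of l', so that y + a1 s m stays in this ideal and the induction applies
   to it. It exists because no strong prime of A divides all of l'. *)
have [|||||s [hs s0 rs _]] := @regular_element A
    (ideal_span (@setTB B) (seq_set l')) (fun=> False) sA.
- by exists (fun=> None).
- by apply/idealTP/span_ideal.
- move=> p e sp _ ne h; have [x xl nx] := hl' p sp.
  have /h px : ideal_span (@setTB B) (seq_set l') x by apply: span_mem.
  have [_ _ _ /(_ x (l'A x xl))[//|rx]] := sp.
  by apply/ne/rx.
- by [].
- move=> h; have bl2 := bl; rewrite el in bl2; move/mapP: bl2 => [x xl eb].
  have /h x0 : ideal_span (@setTB B) (seq_set l') x by apply: span_mem.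
  by move/eqP: b0; apply; rewrite eb x0 mulr0.
have [|||||m [S [eS _ Sx2 _ _]]] := @adjoin A y (a1 * s) t0 (- (g1 * s)) (fun=> False) gA sA.
- by rewrite mulf_neq0.
- by exists (fun=> None).
- by [].
- move=> m S AS; have hS := ss_ring S; have sS := @ss_sat _ S.
  have e1 : g1 * (y + a1 * s * m) = c' - a1 * (t0 + - (g1 * s) * m) by rewrite /c'; ring.
  have e2 : a1 * (t0 + - (g1 * s) * m) = c' - g1 * (y + a1 * s * m) by rewrite /c'; ring.
  split=> h.
    apply: (sS _ a1) => //; first exact: AS.
    by rewrite e2; apply: (subB hS); [apply: AS | apply: (subM hS) => //; apply: AS].
  apply: (sS _ g1) => //; first exact: AS.
  by rewrite e1; apply: (subB hS); [apply: AS | apply: (subM hS) => //; apply: AS].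
- move=> p sp; have [_ _ _ dich] := sp; have rsp := rs p sp.
  have [x] := hl2 p sp; rewrite !inE => /orP[]/eqP-> nd.
    by left; have [//|r] := dich _ Aa1; apply: regmod_mul.
  right; rewrite -mulrN; have [//|r] := dich _ Ag1; apply: regmod_mul => //.
  by rewrite -mulN1r; apply: regmod_mul => //; apply: regmod_unit; rewrite unitrN1.
have [gS [AS spS] sS] := eS; have hSr := good_ring gS.
pose x1 := y + a1 * s * m; pose x2 := t0 + - (g1 * s) * m.
have Sx1 : S x1.
  apply: (ss_sat (s := S)) (AS _ Ag1) g10 _.
  have -> : g1 * x1 = c' - a1 * x2 by rewrite /c' /x1 /x2; ring.
  by apply: (subB hSr); [apply: AS | apply: (subM hSr) => //; apply: AS].
have hx1 : ideal_span (@setTB B) (seq_set l') x1.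
  apply: spanD => //; have -> : a1 * s * m = (a1 * m) * s by ring.
  exact: (spanM (setTB_ring B)).
have [S' [eS' hS']] := IH l' S x1 szl' gS sS (fun x xl => AS x (l'A x xl)) Sx1 hx1.
have [gS' [SS' _] _] := eS'; have hS'r := good_ring gS'.
exists S'; split; first by apply: extends_trans eS'.
apply/(span_cons hS'r); exists x2, (g * x1); split; first exact: SS'.
  by rewrite el; apply/(span_scale hS'r); exists x1.
by rewrite ecd ea eg /x1 /x2 /c'; ring.
Qed.

End Steps.

(** * The rational numbers inside B *)

Section PrimeField.
Variable B : idomainType.
Hypothesis QB : contains_Q B.

Definition prime_field (b : B) := exists (z : int) (n : nat), b * n.+1%:R = z%:~R.

Lemma prime_field_ring : is_subring prime_field.
Proof.
split; first by exists 1, 0%N; rewrite mul1r.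
split=> x y [z [n ex]] [z' [n' ey]].
  (* Denominators are stored as predecessors: n n' + n + n' is (n + 1)(n' + 1) - 1. *)
  exists (z * n'.+1%:Z - z' * n.+1%:Z), (n * n' + n + n')%N.
  have -> : (n * n' + n + n').+1 = (n.+1 * n'.+1)%N by rewrite mulSn mulnS; ring.
  by rewrite natrM rmorphB !rmorphM /= -ex -ey -!pmulrn; ring.
exists (z * z'), (n * n' + n + n')%N.
have -> : (n * n' + n + n').+1 = (n.+1 * n'.+1)%N by rewrite mulSn mulnS; ring.
by rewrite natrM rmorphM /= -ex -ey; ring.
Qed.

Lemma intr_unit (z : int) : (z%:~R : B) != 0 -> (z%:~R : B) \is a GRing.unit.
Proof.
case: z => [[|n]|n]; rewrite ?eqxx // => _; first exact: QB.
by rewrite NegzE rmorphN unitrN; apply: QB.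
Qed.

Lemma prime_field_unit b : prime_field b -> b != 0 -> b \is a GRing.unit.
Proof.
move=> [z [n e]] b0; have : (z%:~R : B) \is a GRing.unit.
  by apply: intr_unit; rewrite -e mulf_neq0 //; apply: contraTneq (QB n) => ->; rewrite unitr0.
by rewrite -e unitrM => /andP[].
Qed.

Lemma prime_field_sat : saturated prime_field.
Proof.
move=> s t [z [n e]] t0 [z' [n' e']].
have nz k : (k.+1%:R : B) != 0 by apply: contraTneq (QB k) => ->; rewrite unitr0.
have zne : (z%:~R : B) != 0 by rewrite -e mulf_neq0.
have es : s * (z%:~R * n'.+1%:R) = z'%:~R * n.+1%:R by rewrite -e -e'; ring.
case: z {e} zne es => [[|k]|k]; rewrite ?eqxx // => _ es.
  exists (z' * n.+1%:Z), (k * n' + k + n')%N.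
  have -> : (k * n' + k + n').+1 = (k.+1 * n'.+1)%N by rewrite mulSn mulnS; ring.
  by rewrite natrM rmorphM /= -!pmulrn -es.
(* For negative z the sign moves to the numerator, since denominators are positive. *)
exists (- z' * n.+1%:Z), (k * n' + k + n')%N.
have -> : (k * n' + k + n').+1 = (k.+1 * n'.+1)%N by rewrite mulSn mulnS; ring.
rewrite natrM rmorphM rmorphN /= -!pmulrn mulNr -es NegzE rmorphN /= -pmulrn.
by ring.
Qed.

Lemma prime_field_good : good prime_field.
Proof.
split; [exact: prime_field_ring | exact: prime_field_sat |].
move=> s hs s0; exists s, [::]; rewrite big_nil mulr1.
by split=> //; apply: prime_field_unit.
Qed.

Lemma prime_field_count : exists F : int * nat -> B, forall b, prime_field b -> exists t, F t = b.
Proof.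
exists (fun t => t.1%:~R / t.2.+1%:R) => b [z [n e]]; exists (z, n).
by rewrite /= -e mulrK.
Qed.

End PrimeField.

(** * The initial ring with generators for the height one primes *)

Section Initial.
Variables (J : Type) (dec : J -> seq J) (D : J -> Prop).
Hypothesis cD : code_closed dec D.
Variables (B : idomainType) (M : B -> Prop).
Hypothesis QB : contains_Q B.
Hypothesis locB : is_local (@setTB B) M.
Hypothesis smallD : forall X : B -> Prop, sz D X -> (forall b, exists x, X x /\ M (b - x)) -> False.
Variables (T : eqType) (psi : T -> B -> Prop) (xs : seq T).
Variable far : T -> (B -> Prop) -> Prop.
Hypothesis psi_prime : forall i, i \in xs -> is_prime (@setTB B) (psi i).
Hypothesis psi_neq0 : forall i, i \in xs -> ~ subset_ (psi i) (fun x => x = 0).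
Hypothesis psi_ass : forall i b Q, i \in xs -> strict_sub (psi i) Q -> ~ ass_quot b Q.
Hypothesis far_sz : forall i, i \in xs -> sz D (far i).
Hypothesis far_prime : forall i q, i \in xs -> far i q ->
  is_prime (@setTB B) q /\ ~ subset_ (psi i) q.
Hypothesis far_other : forall i j, i \in xs -> j \in xs -> i != j -> far i (psi j).

(** Generators are adjoined one by one to the rationals. The invariant is that the ring meets psi j
    in 0 for every j still to be treated; it makes psi i contain elements regular modulo all strong
    primes constructed so far. *)
Lemma initial_ring : exists (S : satsub B) (xt : T -> B), [/\ good S, sz D S &
  forall i, i \in xs -> [/\ sprime S (xt i), psi i (xt i) & forall q, far i q -> ~ q (xt i)]].
Proof.
suff [S [xt [gS sS hS _]]] : exists (S : satsub B) (xt : T -> B), [/\ good S, sz D S,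
  forall i, i \in xs -> [/\ sprime S (xt i), psi i (xt i) & forall q, far i q -> ~ q (xt i)]
  & forall j, j \in xs -> j \notin xs -> forall b, S b -> psi j b -> b = 0] by exists S, xt.
suff key (s : seq T) : {subset s <= xs} -> exists (S : satsub B) (xt : T -> B), [/\ good S, sz D S,
  forall i, i \in s -> [/\ sprime S (xt i), psi i (xt i) & forall q, far i q -> ~ q (xt i)]
  & forall j, j \in xs -> j \notin s -> forall b, S b -> psi j b -> b = 0] by apply: key.
elim: s => [|i s IH] sxs.
  exists (SatSub (prime_field_ring B) (prime_field_sat QB)), (fun=> 0).
  split=> //.
  - exact: prime_field_good.
  - have [F hF] := prime_field_count QB.
    apply: sz_sub (sz_img F (sz_count cD (fun=> True))) => b /hF[t <-].
    by exists t.
  - move=> j jxs _ b hb jb; apply/eqP; apply: contrapT => /negP b0.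
    have := prime_field_unit QB hb b0; move/(local_unit locB); apply.
    exact: (prime_local locB (psi_prime jxs)).
have [|S [xt [gS sS hS h0]]] := IH; first by move=> j js; apply: sxs; rewrite inE js orbT.
have ixs : i \in xs by apply/sxs/mem_head.
have [is_|nis] := boolP (i \in s).
  exists S, xt; split=> //.
    by move=> j; rewrite inE => /orP[/eqP->|]; apply: hS.
  by move=> j jxs; rewrite inE negb_or => /andP[_]; apply: h0.
have pri := psi_prime ixs.
have [|||be [psibe be0 hbe fbe]] := @regular_element J dec D cD B M locB smallD S (psi i) (far i) sS
  (far_sz ixs) (primeT_ideal pri).
- move=> p c sp qp nc sub; have [Sp p0 _ _] := sp.
  (* An associated prime of p that contains psi i either equals it, and then p lies in S ∩ psi i =
     0, or is strictly larger, which [psi_ass] excludes. *)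
  have [eq|neq] := EM (subset_ (colon p c) (psi i)).
    move/eqP: p0; apply; apply: (h0 i) => //; apply: eq.
    by exists c.
  apply: (psi_ass (b := p) ixs _ (ass_colon qp)); split=> //.
  apply: contrapT => no; apply: neq => x px; apply: contrapT => nx.
  by apply: no; exists x.
- by move=> q /(far_prime ixs).
- exact: psi_neq0.
have [|||m [S' [eS' eadj _ transc [gen gEx]]]] := @adjoin J dec D cD B M locB smallD S 0 be 0 be
  (far i) gS sS be0 (far_sz ixs).
- by move=> q hq; have [h1 _] := far_prime ixs hq; split=> //; apply: fbe.
- by [].
- by move=> p /hbe; left.
rewrite add0r in eadj transc gen gEx; set y := be * m in eadj transc gen gEx.
have [gS' extS' sS'] := eS'.
have [p0 _ pM] := primeT_ideal pri.
have piy : psi i y by rewrite /y mulrC; apply: pM.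
have nXc (q : B -> Prop) : ~ q 1 -> ~ (forall k, q (val ('X : {poly ss_type S})`_k)).
  by move=> n1 /(_ 1%N); rewrite coefX /=; apply: n1.
have fy q : far i q -> ~ q y.
  move=> fq; have [[_ [n1 _]] _] := far_prime ixs fq.
  by rewrite -(@evX B S y); apply: gEx => //; apply: nXc.
have ny : ~ dvd y 1.
  by move/unit_dvd1/(local_unit locB); apply; apply: (prime_local locB pri).
have spy : sprime S' y.
  rewrite eadj; apply: sprime_gen => // p sp.
  rewrite -[X in regmod p X](@evX B S y); apply: gen => //; first exact: hbe.
  by apply: nXc; case: sp.
exists S', (fun j => if j == i then y else xt j); split=> //.
- move=> j; rewrite inE; have [-> _|ji /= js] := eqVneq j i; first by split.
  have [h1 h2 h3] := hS j js; split=> //.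
  by have [_ h] := extS'; apply: h.
- move=> j jxs; rewrite inE negb_or => /andP[ji js] b; rewrite eadj => -[f [g [g0 e]]] jb.
  have fj : far i (psi j) by apply: far_other => //; rewrite eq_sym.
  have [_ _ jM] := primeT_ideal (psi_prime jxs).
  (* psi j is one of the primes kept away from i, so f(y) in psi j forces all coefficients of f into
     psi j, where the invariant makes them 0. *)
  have f0 : f = 0.
    apply/polyP => k; rewrite coef0; apply: val_inj => /=.
    apply: (h0 j) => //; first exact: ss_valA.
    apply: contrapT => nk; apply: (gEx _ fj f); last by rewrite -e; apply: jM.
    by move=> /(_ k).
  by apply: (mulfI g0); rewrite mulr0 e f0 ev0.
Qed.

End Initial.

(** * Strict well-orders *)

Record wo_rel (T : Type) (lt : T -> T -> Prop) : Prop := WoRel {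
  wo_wf : well_founded lt;
  wo_total : forall x y, [\/ lt x y, x = y | lt y x];
  wo_trans : forall y x z, lt x y -> lt y z -> lt x z }.

Lemma well_orderable (T : eqType) : exists lt : T -> T -> Prop, wo_rel lt.
Proof.
have [R woR] := wochoice.well_ordering_principle T.
have ch : {in predT &, total R}.
  by apply: wochoice.wo_chainW => A _; apply: woR.
have asym x y : R x y -> R y x -> x = y.
  move=> xy yx; have : {in predT &, antisymmetric R}.
    by apply: wochoice.wo_chain_antisymmetric => A _; apply: woR.
  by move=> /(_ x y isT isT); apply; rewrite xy.
have minR (P : T -> Prop) : (exists x, P x) -> exists z, P z /\ forall x, P x -> R z x.
  move=> [x Px]; have [|z [[Az lbz] _]] := woR (fun x => `[<P x>]).
    by exists x; apply/asboolP.
  exists z; split=> [|y Py]; first exact/asboolP.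
  by apply: lbz; apply/asboolP.
exists (fun x y => R x y /\ x <> y); split.
- move=> x; apply: contrapT => nx.
  have [|z [nz zmin]] := minR (fun x => ~ Acc (fun x y => R x y /\ x <> y) x).
    by exists x.
  apply: nz; constructor=> y [yz ne]; apply: contrapT => ny.
  by apply: ne; apply: asym => //; apply: zmin.
- move=> x y; have [->|ne] := eqVneq x y; first by constructor 2.
  have /orP[h|h] := ch x y isT isT; [constructor 1 | constructor 3]; split=> //.
    exact/eqP.
  by apply/eqP; rewrite eq_sym.
- move=> y x z [xy nxy] [yz nyz].
  have xz : R x z.
    (* Transitivity is read off from the least element of the set of x, y and z. *)
    have [|w [hw wmin]] := minR (fun t => [\/ t = x, t = y | t = z]).
      by exists x; constructor 1.
    case: hw wmin => -> wmin.
    + by apply: wmin; constructor 3.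
    + by case: nxy; apply: asym => //; apply: wmin; constructor 1.
    + by case: nyz; apply: asym => //; apply: wmin; constructor 2.
  by split=> // e; apply: nxy; apply: asym => //; rewrite e.
Qed.

Lemma wo_min (T : Type) (lt : T -> T -> Prop) (P : T -> Prop) : wo_rel lt ->
  (exists x, P x) -> exists x, P x /\ forall y, lt y x -> ~ P y.
Proof.
move=> h [x Px]; apply: contrapT => no; move: Px; elim: (wo_wf h x) => y _ IH Py.
by apply: no; exists y; split.
Qed.

(** * Words over a well-ordered alphabet as codes of lists of words *)

Section Codes.
Variable I : Type.
Definition code := seq (nat + I).

Definition push (s : nat + I) (acc : seq code) :=
  if acc is h :: t then (s :: h) :: t else [::].

(** The letter [inl 0] closes an entry and the other natural letters stand for their predecessors. A
    list of words over P is thus coded by a word over the same P. *)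
Fixpoint dec (l : code) : seq code :=
  match l with
  | [::] => [::]
  | inl 0%N :: l' => [::] :: dec l'
  | inl n.+1 :: l' => push (inl n) (dec l')
  | inr i :: l' => push (inr i) (dec l')
  end.

Definition lift_sym (s : nat + I) : nat + I :=
  match s with inl n => inl n.+1 | inr i => inr i end.

Fixpoint enc (ls : seq code) : code :=
  if ls is l :: ls' then [seq lift_sym s | s <- l] ++ inl 0%N :: enc ls' else [::].

Lemma encK ls : dec (enc ls) = ls.
Proof.
elim: ls => //= l ls IH.
suff -> (k : code) : dec ([seq lift_sym s | s <- l] ++ inl 0%N :: k) = l :: dec k by rewrite IH.
by elim: l => //= -[n|i] l IHl /=; rewrite IHl.
Qed.

Definition syms (P : I -> Prop) : code -> Prop :=
  Allp (fun s => match s with inl _ => True | inr i => P i end).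

Lemma syms_sub (P Q : I -> Prop) l : (forall i, P i -> Q i) -> syms P l -> syms Q l.
Proof. by move=> h; elim: l => //= -[n|i] l IH [? /IH ?]; split=> //; apply: h. Qed.

Lemma syms_cat P (l k : code) : syms P (l ++ k) <-> syms P l /\ syms P k.
Proof.
elim: l => [|s l IH] /=; first by split=> [|[]].
split=> [[h /IH[h1 h2]]|[[h h1] h2]]; first by do 2!split=> //.
by split=> //; apply/IH.
Qed.

Lemma syms_closed P : code_closed dec (syms P).
Proof.
move=> ls h; exists (enc ls); rewrite encK; split=> //.
elim: ls h => //= l ls IH [hl /IH hls]; apply/syms_cat; split=> //=.
by elim: l hl => //= -[n|i] l IHl [? /IHl ?].
Qed.

Variable lt : I -> I -> Prop.
Hypothesis woI : wo_rel lt.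

Fixpoint mx (l : code) : option I :=
  match l with
  | [::] => None
  | inl _ :: l' => mx l'
  | inr i :: l' => if mx l' is Some k then if pselect (lt i k) then Some k else Some i
                   else Some i
  end.

Definition below (o : option I) (i : I) : Prop :=
  if o is Some m then lt i m \/ i = m else False.

Definition olt (o o' : option I) : Prop :=
  match o, o' with
  | None, Some _ => True
  | Some a, Some b => lt a b
  | _, None => False
  end.

Lemma olt_wf : well_founded olt.
Proof.
have hN : Acc olt None by constructor=> -[].
move=> [a|]; last exact: hN.
by elim: (wo_wf woI a) => b _ IH; constructor=> -[c|] h; [apply: IH | apply: hN].
Qed.

Lemma olt_total o o' : [\/ olt o o', o = o' | olt o' o].
Proof.
case: o o' => [a|] [b|] /=; [|by constructor 3|by constructor 1|by constructor 2].
by have [h|->|h] := wo_total woI a b; [constructor 1|constructor 2|constructor 3].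
Qed.

Lemma olt_trans o' o o'' : olt o o' -> olt o' o'' -> olt o o''.
Proof. by case: o o' o'' => [a|] [b|] [c|] //=; apply: wo_trans. Qed.

Lemma below_mono o o' : olt o o' \/ o = o' -> forall i, below o i -> below o' i.
Proof.
move=> [|<- //]; case: o o' => [a|] [b|] //= ab i [ia|->]; left=> //.
exact: (wo_trans woI ia).
Qed.

Lemma syms_mx l : syms (below (mx l)) l.
Proof.
elim: l => //= -[n|i] l IH //=; case: (mx l) IH => [k|] IH.
  case: pselect => [ik|nik]; split.
  - by left.
  - exact: IH.
  - by right.
  - apply: syms_sub IH => j /= [jk|->]; have [//|e|ki] := wo_total woI i k.
    + by left; rewrite e.
    + by left; apply: (wo_trans woI jk).
    + by right.
    + by left.
by split; [right | apply: syms_sub IH].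
Qed.

Lemma mx_mem P l m : syms P l -> mx l = Some m -> P m.
Proof.
elim: l m => //= -[n|i] l IH m [hi hl] /=; first exact: IH.
case e : (mx l) => [k|] => [|[<-] //].
by case: pselect => _ [<-] //; apply: IH e.
Qed.

End Codes.

(** The largest symbol decides and an arbitrary well-order of all words breaks ties, as in Goedel's
    ordering of tuples of ordinals. *)
Lemma godel_order (I : Type) (lt : I -> I -> Prop) : wo_rel lt ->
  exists glt : code I -> code I -> Prop, wo_rel glt /\
    forall i j, glt i j -> olt lt (mx lt i) (mx lt j) \/ mx lt i = mx lt j.
Proof.
move=> woI; have [lt2 wo2] := @well_orderable {classic (code I)}.
pose glt (i j : code I) := olt lt (mx lt i) (mx lt j) \/ mx lt i = mx lt j /\ lt2 i j.
exists glt; split; last by move=> i j [h|[h _]]; [left|right].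
split.
- suff H o : forall i, mx lt i = o -> Acc glt i by move=> i; apply: (H (mx lt i)).
  elim: (olt_wf woI o) => {}o _ IHo i.
  elim: (wo_wf wo2 i) => {}i _ IHi ei; constructor=> k [|[e k2]].
    by rewrite ei => h; apply: (IHo _ h).
  by apply: IHi => //; rewrite e.
- move=> i j; have [h|e|h] := olt_total woI (mx lt i) (mx lt j).
  + by constructor 1; left.
  + have [h|->|h] := wo_total wo2 i j; [constructor 1|constructor 2|constructor 3] => //.
      by right.
    by right.
  + by constructor 3; left.
- move=> j i k [h|[e h]] [h'|[e' h']].
  + by left; apply: olt_trans h'.
  + by left; rewrite -e'.
  + by left; rewrite e.
  + by right; split; [rewrite e | apply: (wo_trans wo2 h)].
Qed.

(** * The index set of the tower *)

Section Indexing.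
Variables (B : idomainType) (M : B -> Prop).
Hypothesis locB : is_local (@setTB B) M.
Hypothesis uncount : ~ (exists s : nat -> B, forall b, exists k, M (b - s k)).

Definition small (J : Type) (D : J -> Prop) := forall X : B -> Prop,
  sz D X -> (forall b, exists x, X x /\ M (b - x)) -> False.

(* Codes are ordered first by their largest symbol, so that an initial segment consists of
   words over a proper initial segment of symbols; the symbols are cut at the first point
   where words over them are numerous enough to cover the residue field. *)
Lemma index_order : exists (J : Type) (dc : J -> seq J) (lt : J -> J -> Prop)
    (top : J -> Prop) (D : J -> J -> Prop) (D0 : J -> Prop),
  [/\ wo_rel lt, code_closed dc top,
      exists X : B -> Prop, sz top X /\ (forall b, exists x, X x /\ M (b - x)),
      [/\ code_closed dc D0, small D0 & forall i, D0 i -> top i] &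
      forall j, top j -> [/\ code_closed dc (D j), small (D j),
        forall i, D0 i -> D j i,
        D j j /\ forall i, lt i j -> D j i /\ top i &
        forall i, lt i j -> forall k, D i k -> D j k]].
Proof.
have [lt woI] := well_orderable B.
pose big (P : B -> Prop) := exists X : B -> Prop,
  sz (syms P) X /\ (forall b, exists x, X x /\ M (b - x)).
have [P0 [bP0 Pdown Pbelow]] : exists P0 : B -> Prop, [/\ big P0,
    forall i j, lt i j -> P0 j -> P0 i & forall m, P0 m -> ~ big (fun i => lt i m)].
  have [ex|no] := EM (exists m, big (fun i => lt i m)).
    have [m [bm mmin]] := wo_min woI ex.
    exists (fun i => lt i m); split; [exact: bm | | exact: mmin].
    by move=> i j ij jm; apply: (wo_trans woI ij).
  (* No proper initial segment suffices: all of B serves as alphabet, and one-letter words already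
     cover. *)
  exists (fun=> True); split=> //; last by move=> m _ h; apply: no; exists m.
  exists (fun=> True); split; last first.
    by move=> b; exists b; rewrite subrr; split=> //; have [] := local_ideal locB.
  exists (fun l : code B => if l is [:: inr b] then Some b else None) => b _.
  by exists [:: inr b].
(* Words in natural letters alone are countable, and B/M is not. *)
have small0 : small (syms (fun _ : B => False)).
  move=> X [F hF] cov; apply: uncount.
  exists (fun k => odflt 0 (obind (fun l : seq nat => F [seq inl n | n <- l]) (unpickle k))) => b.
  have [x [Xx Mx]] := cov b; have [l [hl e]] := hF x Xx.
  have [l' el] : exists l' : seq nat, l = [seq inl n | n <- l'].
    elim: (l) hl => [|[n|i] k IH] /=; [by exists [::] | move=> [_ /IH[k' ->]] | by case].
    by exists (n :: k').
  by exists (pickle l'); rewrite pickleK /= -el e.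
(* Allowing m itself adds nothing: m is recoded as the natural letter 0 and the natural letters move
   up by one, so words with symbols at most m are images of words with symbols below m. *)
have smallS m : P0 m -> small (syms (below lt (Some m))).
  move=> Pm X [F hF] cov; apply: (Pbelow m Pm); exists X; split=> //.
  pose tr (s : nat + B) : nat + B := match s with
    | inl 0%N => inr m | inl n.+1 => inl n | inr i => inr i end.
  exists (fun l => F [seq tr s | s <- l]) => x /hF[l [hl e]].
  suff [k [hk ek]] : exists k, syms (fun i => lt i m) k /\ [seq tr s | s <- k] = l.
    by exists k; rewrite ek.
  elim: (l) hl => [|s l' IH] /=; first by exists [::].
  move=> [hs /IH[k [hk <-]]]; case: s hs => [n _|i [im|->]].
  - by exists (inl n.+1 :: k).
  - by exists (inr i :: k).
  - by exists (inl 0%N :: k).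
have [glt [wog gmx]] := godel_order woI.
exists (code B), (@dec B), glt, (syms P0), (fun j => syms (below lt (mx lt j))), (syms (fun=> False)).
split=> //; first exact: syms_closed.
  by split=> //; [apply: syms_closed | move=> i; apply: syms_sub].
move=> j tj; split.
- exact: syms_closed.
- case e : (mx lt j) => [m|]; last exact: small0.
  exact/smallS/(mx_mem tj e).
- by move=> i; apply: syms_sub.
- split; first exact: syms_mx.
  move=> i /gmx ij; have h := below_mono woI ij.
  have hi := syms_sub h (syms_mx woI i).
  split=> //; apply: syms_sub hi => k; case e : (mx lt j) => [m|] //= h'.
  have Pm := mx_mem tj e; case: h' => [km|-> //]; exact: Pdown km Pm.
- by move=> i /gmx ij k; apply: syms_sub; apply: below_mono.
Qed.

End Indexing.

(** * The transfinite tower and its union *)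

Section Tower.
Variables (B : idomainType) (M : B -> Prop).
Hypothesis locB : is_local (@setTB B) M.
Hypothesis uncount : ~ (exists s : nat -> B, forall b, exists k, M (b - s k)).
Variable lift_res : B -> B.
Hypothesis h_inj : forall x y, M (lift_res x - lift_res y) -> x = y.
Hypothesis h_surj : forall b, exists x, M (lift_res x - b).
Hypothesis deepM : deep M.
Variable Init : satsub B -> Prop.
Hypothesis initE : forall (J : Type) (dc : J -> seq J) (D : J -> Prop),
  code_closed dc D -> small M D -> exists A0 : satsub B, [/\ good A0, sz D A0 & Init A0].

Lemma span_mono_ring (R S G : B -> Prop) : subset_ R S ->
  subset_ (ideal_span R G) (ideal_span S G).
Proof. by move=> RS x [l [hl ->]]; exists l; split=> // rp /hl[/RS]. Qed.

Lemma span_prime_mono (P R S : B -> Prop) : idealT P -> subset_ R S ->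
  same_ P (ideal_span (@setTB B) (fun b => R b /\ P b)) ->
  same_ P (ideal_span (@setTB B) (fun b => S b /\ P b)).
Proof.
move=> hP RS e x; split=> [/e|].
  by apply: span_mono => y [/RS].
by apply: span_sub; [apply/idealTP | move=> y []].
Qed.

(** One list serves three purposes: its head is a residue to be hit, head and tail form a linear
    equation, and the whole list generates an ideal that may be a deep prime. R contains the
    coefficients and S the solutions. *)
Definition task_done (l : seq B) (R S : B -> Prop) :=
  [/\ exists a, S a /\ M (head 0 l - a),
      (forall a, a \in l -> R a) -> ideal_span (@setTB B) (seq_set (behead l)) (head 0 l) ->
        ideal_span S (seq_set (behead l)) (head 0 l) &
      is_prime (@setTB B) (ideal_span (@setTB B) (seq_set l)) ->
      deep (ideal_span (@setTB B) (seq_set l)) ->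
      same_ (ideal_span (@setTB B) (seq_set l))
        (ideal_span (@setTB B) (fun b => S b /\ ideal_span (@setTB B) (seq_set l) b))].

Lemma task_step (J : Type) (dc : J -> seq J) (D : J -> Prop) (A : satsub B) (l : seq B) :
  code_closed dc D -> small M D -> good A -> sz D A ->
  exists S : satsub B, extends D A S /\ task_done l A S.
Proof.
move=> cD sD gA sA; set P := ideal_span (@setTB B) (seq_set l).
have [S1 [[g1 e1 s1] h1]] : exists S : satsub B, extends D A S /\
    ((forall a, a \in l -> A a) -> ideal_span (@setTB B) (seq_set (behead l)) (head 0 l) ->
        ideal_span S (seq_set (behead l)) (head 0 l)).
  have [hl|nl] := EM ((forall a, a \in l -> A a) /\
      ideal_span (@setTB B) (seq_set (behead l)) (head 0 l)); last first.
    by exists A; split; [split=> //; apply: ext_refl | move=> h1 h2; case: nl].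
  have [lA hs] := hl.
  have [||S [eS hS]] := step_ideal cD locB sD gA sA (l := behead l) (c := head 0 l) _ _ hs.
  - by move=> a al; apply/lA/mem_behead.
  - case: (l) lA => [_|a l' lA]; first exact: (sub0 (good_ring gA)).
    exact/lA/mem_head.
  by exists S.
have [S2 [[g2 e2 s2] [a [S2a Ma]]]] := step_residue cD locB sD (head 0 l) deepM g1 s1.
have [S3 [[g3 e3 s3] h3]] : exists S : satsub B, extends D S2 S /\
    (is_prime (@setTB B) P -> deep P ->
     same_ P (ideal_span (@setTB B) (fun b => S b /\ P b))).
  have [[Pp Pd]|n] := EM (is_prime (@setTB B) P /\ deep P).
    by have [S [eS hS]] := step_prime cD locB sD deepM Pd Pp g2 s2; exists S.
  by exists S2; split; [split=> //; apply: ext_refl | move=> h2 h3; case: n].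
have e13 := ext_trans e2 e3.
exists S3; split; first by split=> //; apply: ext_trans e13.
split=> //.
- by exists a; split=> //; case: e3 => h _; apply: h.
- by move=> lA hs; apply: (span_mono_ring (R := S1)); [case: e13 | apply: h1].
Qed.

Section Recursion.
Variables (J : Type) (dc : J -> seq J) (lt : J -> J -> Prop) (top : J -> Prop).
Variables (D : J -> J -> Prop) (D0 : J -> Prop) (A0 : satsub B) (task : J -> seq B).
Hypothesis woJ : wo_rel lt.
Hypothesis hD : forall j, top j -> [/\ code_closed dc (D j), small M (D j),
  forall i, D0 i -> D j i, D j j /\ forall i, lt i j -> D j i /\ top i &
  forall i, lt i j -> forall k, D i k -> D j k].
Hypothesis gA0 : good A0.
Hypothesis sA0 : sz D0 A0.

Definition stage_ok j (U S : B -> Prop) :=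
  [/\ good S, ext U S, sz (D j) S & task_done (task j) U S].

(** The default U does not occur at indices in [top], by [stage_inv]. *)
Definition next j (U : B -> Prop) : B -> Prop :=
  if pselect (exists S, stage_ok j U S) is left e then sval (cid e) else U.

Definition stage : J -> B -> Prop := Fix (wo_wf woJ) (fun _ => B -> Prop)
  (fun j rec => next j (fun x => A0 x \/ exists i (ij : lt i j), rec i ij x)).

Definition before j (x : B) := A0 x \/ exists i (ij : lt i j), stage i x.

Lemma stageE j : stage j = next j (before j).
Proof.
rewrite /stage Fix_eq // => k f g fg; congr (next k _).
apply/predeqP => x; split=> -[h|[i [ij h]]]; [by left|right|by left|right];
  by exists i, ij; rewrite ?fg // -fg.
Qed.

(** Transfinite induction. The stages before j form a chain, so their union with A0 is good. It has
    size [D j], because [D j] contains all indices i below j and all the sets [D i]. Hence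
    [task_step] applies to it. *)
Lemma stage_inv j : top j ->
  [/\ stage_ok j (before j) (stage j), ext A0 (stage j) &
      forall i, lt i j -> ext (stage i) (stage j)].
Proof.
elim: (wo_wf woJ j) => {}j _ IH tj; have [cD sD D0j [_ Dj] Dm] := hD tj.
(* [None] stands for A0, which keeps the family inhabited at the first index. *)
pose F (o : option {i | lt i j}) : B -> Prop :=
  if o is Some i then stage (sval i) else A0.
have FE : before j = (fun x => exists o, F o x).
  apply/predeqP => x; split=> [[h|[i [ij h]]]|[[[i ij]|] h]].
  - by exists None.
  - by exists (Some (exist _ i ij)).
  - by right; exists i, ij.
  - by left.
have [|||gU eU] := @good_union B _ F.
- by exists None.
- have top_i (i : {i | lt i j}) : top (sval i) by case: i => i ij; case: (Dj i ij).
  have eA i : ext A0 (F i).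
    case: i => [i|]; last exact: ext_refl.
    by have [] := IH _ (svalP i) (top_i i).
  move=> [a|] [b|]; last by exists None; split; apply: ext_refl.
  - have [ab|ab|ba] := wo_total woJ (sval a) (sval b).
    + by exists (Some b); split; [have [_ _ h] := IH _ (svalP b) (top_i b); apply: h | apply: ext_refl].
    + by exists (Some b); split; rewrite /= ?ab; apply: ext_refl.
    + by exists (Some a); split; [apply: ext_refl | have [_ _ h] := IH _ (svalP a) (top_i a); apply: h].
  - by exists (Some a); split; [apply: ext_refl | apply: eA].
  - by exists (Some b); split; [apply: eA | apply: ext_refl].
- case=> [[i ij]|] //=; have [_ ti] := Dj i ij.
  by have [[]] := IH i ij ti.
rewrite -FE in gU eU.
have sU : sz (D j) (before j).
  apply: (sz_union cD).
    by have [G hG] := sA0; exists G => x /hG[k [Dk e]]; exists k; split=> //; apply: D0j.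
  have sI : sz (D j) (fun i => lt i j) by exists Some => i /Dj[h _]; exists i.
  apply: (sz_sub _ (sz_bigcup cD (Y := stage) sI _)).
    by move=> x [i [ij hx]]; exists i.
  move=> i ij; have [_ ti] := Dj i ij; have [[_ _ [G hG] _] _ _] := IH i ij ti.
  by exists G => x /hG[k [Dk e]]; exists k; split=> //; apply: (Dm i).
have ok : stage_ok j (before j) (stage j).
  rewrite stageE /next; case: pselect => [e|[]]; first by case: cid.
  pose U := SatSub (good_ring gU) (good_sat gU).
  have [S [[gS eS sS] tS]] := @task_step J dc (D j) U (task j) cD sD gU sU.
  by exists S.
split=> //; have [_ eUS _ _] := ok; first exact: ext_trans (eU None) eUS.
by move=> i ij; apply: ext_trans (eU (Some (exist _ i ij))) eUS.
Qed.

Hypothesis task_cofinal : forall l j0, top j0 ->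
  exists j, [/\ top j, task j = l & lt j0 j].
Hypothesis topN : exists j, top j.

(** If all entries of l lie in the union, they lie in a single stage j0, and some later index has l
    as its task; what is achieved there survives in the union. *)
Lemma tower_union : exists A : satsub B,
  [/\ good A, ext A0 A & forall l, task_done l A A].
Proof.
pose F (j : {j | top j}) := stage (sval j).
have eF (a b : {j | top j}) : sval a = sval b \/ lt (sval a) (sval b) -> ext (F a) (F b).
  rewrite /F => -[->|ab]; first exact: ext_refl.
  by have [_ _ h] := stage_inv (svalP b); apply: h.
have [|||gU eU] := @good_union B _ F.
- by have [j tj] := topN; exists (exist _ j tj).
- move=> a b; have [ab|ab|ba] := wo_total woJ (sval a) (sval b).
  + by exists b; split; apply: eF; [right|left].
  + by exists b; split; apply: eF; left.
  + by exists a; split; apply: eF; [left|right].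
- by move=> a; have [[]] := stage_inv (svalP a).
exists (SatSub (good_ring gU) (good_sat gU)); split=> //=.
  have [j tj] := topN; have [_ e0 _] := stage_inv tj.
  exact: ext_trans e0 (eU (exist _ j tj)).
move=> l.
have [j0 [tj0 hj0]] : exists j0, top j0 /\
    ((forall a, a \in l -> exists i, F i a) -> forall a, a \in l -> stage j0 a).
  have [hl|nl] := EM (forall a, a \in l -> exists i, F i a); last first.
    by have [j tj] := topN; exists j.
  suff [j0 [tj0 h0]] : exists j0, top j0 /\ forall a, a \in l -> stage j0 a by exists j0.
  elim: l hl => [|a l IH] hl; first by have [j tj] := topN; exists j.
  have [|j [tj hj]] := IH; first by move=> b bl; apply: hl; rewrite inE bl orbT.
  have [[i ti] Fi] := hl a (mem_head _ _); rewrite /F /= in Fi.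
  have [ij|ij|ji] := wo_total woJ i j.
  - exists j; split=> // b; rewrite inE => /orP[/eqP->|/hj //].
    by have [_ _ /(_ i ij)[h1 _]] := stage_inv tj; apply: h1.
  - by exists j; split=> // b; rewrite inE => /orP[/eqP->|/hj //]; rewrite -ij.
  - exists i; split=> // b; rewrite inE => /orP[/eqP-> //|/hj bj].
    by have [_ _ /(_ j ji)[h1 _]] := stage_inv ti; apply: h1.
have [j [tj ej j0j]] := task_cofinal l tj0.
have [[_ _ _ tS] _ _] := stage_inv tj; move: tS; rewrite ej => -[t1 t2 t3].
pose P := ideal_span (@setTB B) (seq_set l).
have SA : subset_ (stage j) (fun x => exists i, F i x).
  by move=> x hx; exists (exist _ j tj).
split.
- by have [a [Sa Ma]] := t1; exists a; split=> //; apply: SA.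
- move=> lA hs; apply: (span_mono_ring SA); apply: t2 => // a al.
  by right; exists j0, j0j; apply: hj0.
- move=> Pp Pd; have hP := primeT_ideal Pp.
  exact: (span_prime_mono hP SA (t3 Pp Pd)).
Qed.

End Recursion.
Theorem tower : exists A0 A : satsub B,
  [/\ Init A0, good A, ext A0 A & forall l, task_done l A A].
Proof.
have [J [dc [lt [top [D [D0 [woJ ctop [X [sX cov]] [cD0 sD0 D0top] hD]]]]]]] :=
  index_order locB uncount.
have [A0 [gA0 sA0 iA0]] := initE cD0 sD0.
(* The equality of |B| and |B/M| enters here: [lift_res] represents a bijection from B to B/M, so
   indices that cover B/M also index B. *)
have sB : sz top (fun _ : B => True).
  have /choice[inv hinv] y : exists x, M (lift_res x - y) by apply: h_surj.
  apply: sz_sub (sz_img inv sX) => b _; have [x [Xx Mx]] := cov (lift_res b).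
  exists x; split=> //; apply: h_inj.
  have := ideal_sub (local_ideal locB) Mx (hinv x).
  by rewrite opprB addrA subrK.
(* Tasks are indexed by pairs (b, l), so that each list l recurs once for every label b in B. *)
have [G hG] : sz top (fun p : B * seq B => True /\ True).
  apply: (sz_sigma ctop (X := fun _ : B => True) (Y := fun _ (_ : seq B) => True)) => // _ _.
  by apply: sz_sub (sz_list ctop sB) => l _; apply/AllpP.
pose task j := if G j is Some p then p.2 else [::].
have topN : exists j, top j by apply: code_nil ctop.
(* If l did not recur after j0, all labels b would be indexed by j0 and its predecessors, hence by
   [D j0], which is too small. *)
have cofinal l j0 : top j0 -> exists j, [/\ top j, task j = l & lt j0 j].
  move=> tj0; apply: contrapT => no; have [_ sj0 _ [Dj0 Dlt] _] := hD j0 tj0.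
  apply: (sj0 (fun _ => True)); last first.
    by move=> b; exists b; rewrite subrr; split=> //; have [] := local_ideal locB.
  exists (fun j => omap fst (G j)) => b _.
  have [j [tj ej]] := hG (b, l) (conj I I); exists j; rewrite ej; split=> //.
  have [h1|-> //|h1] := wo_total woJ j j0; first by case: (Dlt j h1).
  by case: no; exists j; rewrite /task ej.
have [A [gA eA tA]] := tower_union woJ hD gA0 sA0 cofinal topN.
by exists A0, A.
Qed.

End Tower.

(** * Good rings are factorial *)

Section Factorial.
Variables (B : idomainType) (A : satsub B).
Hypothesis gA : good A.
Let hA := good_ring gA.
Let sA := good_sat gA.

Lemma unit_inP u : unit_in A u <-> A u /\ u \is a GRing.unit.
Proof.
split=> [[Au [v [_ e]]]|[Au uu]].
  by split=> //; apply/unit_dvd1; exists v.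
by split=> //; exists u^-1; rewrite divrr //; split=> //; apply: (sat_unit hA sA).
Qed.

Lemma sprime_assoc p w : sprime A p -> A w -> w \is a GRing.unit -> sprime A (w * p).
Proof.
move=> [Ap p0 np hp] Aw uw; have w0 : w != 0 by apply: contraTneq uw => ->; rewrite unitr0.
have dE s : dvd (w * p) s <-> dvd p s.
  split=> [[c ->]|[c ->]]; first by exists (w * c); ring.
  by exists (w^-1 * c); rewrite mulrACA divrr // mul1r.
split; [exact: (subM hA) | by rewrite mulf_neq0 | by move/dE | move=> s As].
by have [/dE|r] := hp s As; [left | right=> c /dE/r/dE].
Qed.

Lemma sprime_irred_in p : sprime A p -> irred_in A p.
Proof.
move=> [Ap p0 np hp]; split=> //; split=> //; split.
  by move=> /unit_inP[_ /unit_dvd1].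
have key a b : A a -> A b -> p = a * b -> dvd p a -> unit_in A b.
  move=> Aa Ab e [c ea]; apply/unit_inP; split=> //; apply/unit_dvd1.
  by exists c; apply: (mulfI p0); rewrite mulr1 {1}e ea; ring.
move=> a b Aa Ab e; have [pa|ra] := hp a Aa; first by right; apply: key e pa.
left; apply: (key b a) => //; first by rewrite mulrC.
by apply: ra; rewrite -e; apply: dvd_refl.
Qed.

(** The cofactor of the first strong prime in the factorization of p lies in A by saturation, and
    irreducibility makes it a unit. *)
Lemma irred_in_sprime p : irred_in A p -> sprime A p.
Proof.
move=> [Ap [p0 [nu irr]]]; have [u [l [uu hl e]]] := good_fact gA Ap p0.
case: l hl e => [_ e|q l hl e].
  by case: nu; apply/unit_inP; split=> //; rewrite e big_nil mulr1.
have sq : sprime A q by apply/hl/mem_head.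
have [Aq q0 nq _] := sq.
have e' : p = q * (u * \prod_(r <- l) r) by rewrite e big_cons mulrCA.
have Aw : A (u * \prod_(r <- l) r) by apply: (sA Aq q0); rewrite -e'.
have [/unit_inP[_ /unit_dvd1]//|/unit_inP[_ uw]] := irr _ _ Aq Aw e'.
by rewrite e' mulrC; apply: sprime_assoc.
Qed.

Lemma sprime_dvd_prod p w (s : seq B) : sprime A p -> (forall q, q \in s -> A q) ->
  w \is a GRing.unit -> dvd p (w * \prod_(q <- s) q) -> exists2 q, q \in s & dvd p q.
Proof.
move=> [Ap p0 np hp]; elim: s w => [|q s IH] w sAq uw.
  by rewrite big_nil mulr1 => h; case: np; apply: dvd_trans h _; apply/unit_dvd1.
rewrite big_cons mulrCA => h; have [pq|rq] := hp q (sAq q (mem_head _ _)).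
  by exists q => //; apply: mem_head.
have [||r rs pr] := IH w _ uw; last by exists r => //; rewrite inE rs orbT.
  by move=> r rs; apply: sAq; rewrite inE rs orbT.
exact: rq.
Qed.

(** Irreducible elements and strong primes of A coincide, and a strong prime dividing a product
    divides a factor, so the usual matching of factors applies. *)
Lemma ufd_of_good : is_ufd A.
Proof.
split.
  move=> a Aa a0 nu; have [u [l [uu hl e]]] := good_fact gA Aa a0.
  case: l hl e => [_ e|q l hl e].
    by case: nu; apply/unit_inP; split=> //; rewrite e big_nil mulr1.
  have Al : A (\prod_(r <- q :: l) r) by apply: (sub_prod hA) => r /hl[].
  have Au : A u.
    apply: (sA Al); last by rewrite mulrC -e.
    by apply: contraNneq a0; rewrite e => ->; rewrite mulr0.
  (* The unit is absorbed into the first prime. *)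
  exists (u * q :: l); split; last by rewrite e !big_cons mulrA.
  move=> p; rewrite inE => /orP[/eqP->|pl]; apply: sprime_irred_in.
    by apply: sprime_assoc => //; apply/hl/mem_head.
  by apply: hl; rewrite inE pl orbT.
(* The extra unit w collects the units left over when matched factors are cancelled. *)
suff main s1 s2 w : (forall p, p \in s1 -> irred_in A p) -> (forall p, p \in s2 -> irred_in A p) ->
    w \is a GRing.unit -> \prod_(p <- s1) p = w * \prod_(p <- s2) p ->
    size s1 = size s2 /\ exists s2', perm_eq s2 s2' /\
       forall i, (i < size s1)%N -> assoc_in A (nth 0 s1 i) (nth 0 s2' i).
  by move=> s1 s2 h1 h2 e; apply: (main s1 s2 1) => //; [apply: unitr1 | rewrite mul1r].
elim: s1 s2 w => [|p s1 IH] s2 w h1 h2 uw.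
  case: s2 h2 => [_ _|q s2 h2]; first by split=> //; exists [::].
  rewrite big_nil big_cons => e; have /irred_in_sprime[_ _ nq _] := h2 q (mem_head _ _).
  by case: nq; exists (w * \prod_(r <- s2) r); rewrite mulrCA -e.
rewrite big_cons => e.
have ip := h1 p (mem_head _ _); have sp := irred_in_sprime ip; have [Ap p0 np _] := sp.
have [||q qs [c eq]] := sprime_dvd_prod (s := s2) sp _ uw.
- by move=> q /h2[].
- by rewrite -e; apply: dvd_mulr; apply: dvd_refl.
have [Aq [q0 [_ irq]]] := h2 q qs.
have Ac : A c by apply: (sA Ap p0); rewrite -eq.
have uc : c \is a GRing.unit.
  by have [/unit_inP[_ /unit_dvd1]//|/unit_inP[]] := irq p c Ap Ac eq.
have pr := perm_to_rem qs.
have [||||sz [s2' [pe as']]] := IH (rem q s2) (w * c).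
- by move=> r rs; apply: h1; rewrite inE rs orbT.
- by move=> r /mem_rem/h2.
- by rewrite unitrM uw.
- by apply: (mulfI p0); rewrite e (perm_big _ pr) big_cons {1}eq /=; ring.
split; first by rewrite (perm_size pr) /= sz.
exists (q :: s2'); split; first by rewrite (perm_trans pr) // perm_cons.
case=> [_|i /as' //]; rewrite /assoc_in /=; exists c^-1; split.
  by apply/unit_inP; rewrite unitrV; split=> //; apply: (sat_unit hA sA).
by rewrite eq mulrCA mulVr // mulr1.
Qed.

End Factorial.

(** * Noetherianity, completion and spectrum of A *)

Section Completion.
Variables (B : idomainType) (M : B -> Prop) (A : satsub B).
Hypothesis locB : is_local (@setTB B) M.
Hypothesis residue : forall b, exists a, A a /\ M (b - a).
Hypothesis contract : forall l c, (forall a, a \in l -> A a) -> A c ->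
  ideal_span (@setTB B) (seq_set l) c -> ideal_span A (seq_set l) c.
Hypothesis maxgen : same_ M (ideal_span (@setTB B) (fun b => A b /\ M b)).
Let noethB := local_noeth locB.
Let hA := ss_ring A.
Let mA := (fun a => M a /\ A a).

Lemma contract_span (G : B -> Prop) x : subset_ G A -> A x ->
  ideal_span (@setTB B) G x -> ideal_span A G x.
Proof.
move=> GA Ax Gx; have [s [sG Gs]] := fin_gen noethB G.
have := contract (fun a as_ => GA a (sG a as_)) Ax (Gs x Gx).
exact: span_mono.
Qed.

(** Finitely many elements of I generate IB, and [contract] brings the resulting expressions back to
    A. *)
Lemma sub_noetherian : noetherian A.
Proof.
move=> I hI; have IA := proj1 hI.
have [s [sI Is]] := fin_gen noethB I.
exists s; split=> // x; split=> [Ix|]; last exact: span_sub.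
apply: contract; [by move=> a /sI/IA | exact: IA | ].
by apply: Is; apply: span_mem.
Qed.

Lemma ideal_sub_max (K : B -> Prop) : is_ideal A K -> ~ K 1 -> subset_ K mA.
Proof.
move=> [KA [_ [_ KM]]] K1 x Kx; split; last exact: KA.
apply: contrapT => /(local_unit locB) ux; apply: K1.
rewrite -(mulVr ux); apply: KM => //.
by apply: (sat_unit hA (@ss_sat _ A)) => //; apply: KA.
Qed.

Lemma max_ideal : is_ideal A mA.
Proof.
have [M0 MD MM] := local_ideal locB.
split; first by move=> x [].
split; first by split=> //; apply: (sub0 hA).
split=> [x y [Mx Ax] [My Ay]|r x Ar [Mx Ax]].
  by split; [apply: MD | apply: (subD hA)].
by split; [apply: MM | apply: (subM hA)].
Qed.

Lemma sub_local : is_local A mA.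
Proof.
have n1 : ~ mA 1 by move=> [] /(local_proper locB).
split; first exact: sub_noetherian.
split.
  split; first exact: max_ideal; split=> // K hK K1 mK x.
  by split; [apply: ideal_sub_max | apply: mK].
move=> K [hK [K1 Kmax]] x.
have [e1 e2] := Kmax mA max_ideal n1 (ideal_sub_max hK K1) x.
by split.
Qed.

Lemma pow_gen n : subset_ (ideal_pow (@setTB B) M n) (ideal_span (@setTB B) (prods mA n)).
Proof.
apply: span_sub; first by apply: span_ideal.
move=> x [l [<- [lM ->]]]; elim: l lM => [|y l IH] lM.
  by rewrite big_nil; apply: span_mem => //; exists [::]; rewrite big_nil.
have {}IH := IH (fun z zl => lM z (mem_behead (s := y :: l) zl)).
rewrite big_cons /=; have /maxgen := lM y (mem_head _ _).
move: y {lM}; apply: span_ind.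
- by rewrite mul0r; apply: span0.
- by move=> y z hy hz; rewrite mulrDl; apply: spanD.
move=> r y _ [Ay My]; rewrite -mulrA; apply: (spanM (setTB_ring B)) => //.
move: (\prod_(j <- l) j) IH; apply: span_ind.
- by rewrite mulr0; apply: span0.
- by move=> z t hz ht; rewrite mulrDr; apply: spanD.
move=> r' z _ [k [sk [hk ->]]]; rewrite mulrCA; apply: (spanM (setTB_ring B)) => //.
apply: span_mem => //; exists (y :: k); rewrite /= sk big_cons; split=> //; split=> // t.
by rewrite inE => /orP[/eqP->|/hk].
Qed.

Lemma pow_contract n x : A x -> ideal_pow (@setTB B) M n x -> ideal_pow A mA n x.
Proof.
move=> Ax /pow_gen; apply: contract_span => // y [l [_ [hl ->]]].
by apply: (sub_prod hA) => z /hl[].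
Qed.

Lemma pow_decr n k : (n <= k)%N ->
  subset_ (ideal_pow (@setTB B) M k) (ideal_pow (@setTB B) M n).
Proof.
move=> nk; apply: span_sub; first by apply: span_ideal.
move=> x [l [sl [lM ->]]].
rewrite -(cat_take_drop n l) big_cat /= mulrC; apply: (spanM (setTB_ring B)) => //.
apply: span_mem => //; exists (take n l); split; last first.
  by split=> // y /mem_take/lM.
by rewrite size_takel // sl.
Qed.

(** The error in M^n is a combination over B of products of n elements of mA; approximating its
    coefficients by A modulo M leaves an error in the next power. *)
Lemma dense n b : exists a, A a /\ ideal_pow (@setTB B) M n (b - a).
Proof.
elim: n b => [|n IH] b.
  exists 0; split; first exact: (sub0 hA).
  rewrite -[_ - _]mulr1; apply: (spanM (setTB_ring B)) => //; apply: span_mem => //.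
  by exists [::]; rewrite big_nil.
have [a [Aa /pow_gen h]] := IH b.
suff [c [Ac hc]] : exists c, A c /\ ideal_pow (@setTB B) M n.+1 (b - a - c).
  by exists (a + c); rewrite opprD addrA; split=> //; apply: (subD hA).
move: (b - a) h; apply: span_ind.
- by exists 0; rewrite subrr; split; [apply: (sub0 hA) | apply: span0].
- move=> x y [c [Ac hc]] [e [Ae he]]; exists (c + e); split; first exact: (subD hA).
  by rewrite opprD addrACA; apply: spanD.
move=> r x _ [l [sl [hl ex]]]; have [c [Ac Mc]] := residue r.
have Ax : A x by rewrite ex; apply: (sub_prod hA) => z /hl[].
exists (c * x); split; first exact: (subM hA).
rewrite -mulrBl; apply: span_mem => //; exists (r - c :: l).
rewrite /= sl big_cons ex; split=> //; split=> // y.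
by rewrite inE => /orP[/eqP->|/hl[]].
Qed.

(** M^n ∩ A lies in mA^n, so null sequences agree; by density the k-th term of a Cauchy sequence in
    B is replaced by an element of A congruent to it modulo M^k. *)
Lemma completion : completion_iso A mA M.
Proof.
split=> [u Au _ nu n|v cv].
  by have [N hN] := nu n; exists N => k /hN; apply: pow_contract.
have /choice[u hu] k : exists a, A a /\ ideal_pow (@setTB B) M k (v k - a) by apply: dense.
exists u; have hvu n k : (n <= k)%N -> ideal_pow (@setTB B) M n (u k - v k).
  move=> nk; have [_ h] := hu k; rewrite -opprB -mulN1r.
  by apply: (spanM (setTB_ring B)) => //; apply: pow_decr h.
split; first by move=> k; case: (hu k).
split; last by move=> n; exists n => k; apply: hvu.
move=> n; have [N hN] := cv n; exists (maxn n N) => k l.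
rewrite !geq_max => /andP[nk Nk] /andP[nl Nl].
apply: pow_contract; first by apply: (subB hA); [case: (hu k) | case: (hu l)].
have -> : u k - u l = (u k - v k) + (v k - v l) + -1 * (u l - v l) by ring.
apply: spanD; first by apply: spanD; [apply: hvu | apply: hN].
by apply: (spanM (setTB_ring B)) => //; apply: hvu.
Qed.

(** The ideal P'B contracts to P', so it misses the complement of P' in A; a prime of B containing
    P'B and missing this complement lies over P'. *)
Lemma spec_onto P' : is_prime A P' ->
  exists P, is_prime (@setTB B) P /\ same_ (fun b => A b /\ P b) P'.
Proof.
move=> [hP' [P'1 P'M]]; have P'A := proj1 hP'.
have [||||P [Pp IP PU]] := @prime_disjoint B noethB (fun x => A x /\ ~ P' x)
   (ideal_span (@setTB B) P').
- by split=> //; apply: (sub1 hA).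
- move=> x y [Ax nx] [Ay ny]; split; first exact: (subM hA).
  by move=> /(P'M _ _ Ax Ay)[].
- by apply/idealTP/span_ideal.
- move=> x hx [Ax]; apply.
  by apply: (span_sub hP' (G := P')) => //; apply: contract_span.
exists P; split=> // x; split=> [[Ax Px]|P'x].
  by apply: contrapT => nx; apply: (PU x Px).
by split; [apply: P'A | apply/IP/span_mem].
Qed.

End Completion.

(** * Height one primes of B and height one elements of X *)

Lemma height_one_zero_divisor (B : idomainType) (Q : B -> Prop) y a :
  noetherian (@setTB B) -> is_prime (@setTB B) Q ->
  (forall P, is_prime (@setTB B) P -> strict_sub P Q -> subset_ P (fun x => x = 0)) ->
  Q y -> y != 0 -> Q a -> ~ regmod y a.
Proof.
move=> noethB Qp Qmin Qy y0 Qa ra; have [_ [Q1 QM]] := Qp.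
have regX u k : dvd y (u * a ^+ k) -> dvd y u.
  by elim: k => [|k IH]; rewrite ?mulr1 // exprS mulrCA => /ra.
(* If a is regular modulo y, the products u a^k with u outside Q miss yB. A prime containing y and
   avoiding them lies in Q, omits a and is nonzero, against the minimality of Q. *)
have [||||P [Pp yP PU]] := @prime_disjoint B noethB
    (fun x => exists u k, ~ Q u /\ x = u * a ^+ k) (dvd y).
- by exists 1, 0%N; rewrite mulr1.
- move=> _ _ [u [k [nu ->]]] [u' [k' [nu' ->]]]; exists (u * u'), (k + k')%N.
  by split; [move/(QM _ _ I I) => [] | rewrite exprD mulrACA].
- exact/idealTP/principal_ideal.
- move=> x yx [u [k [nu e]]]; apply: nu; rewrite e in yx.
  have [c ->] := regX u k yx; have [_ _ h] := primeT_ideal Qp.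
  by rewrite mulrC; apply: h.
have PQ : strict_sub P Q.
  split=> [x Px|].
    by apply: contrapT => nx; apply: (PU x Px); exists x, 0%N; rewrite mulr1.
  by exists a; split=> // Pa; apply: (PU a Pa); exists 1, 1%N; rewrite mul1r.
by move/eqP: y0; apply; apply: (Qmin P Pp PQ); apply/yP/dvd_refl.
Qed.

Section Heights.
Variables (d : Order.disp_t) (T : finPOrderType d) (n : nat) (B : idomainType).
Variable psi : T -> B -> Prop.
Hypothesis n2 : (2 <= n)%N.
Hypothesis dimT : poset_dim_eq (T := T) n.
Hypothesis emb : saturated_embedding psi.
Hypothesis dimB : krull_dim_eq B n.

Lemma emb_lt (x y : T) : (x < y)%O -> strict_sub (psi x) (psi y).
Proof.
move=> xy; have [_ [le _]] := emb; split; first by apply/le/ltW.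
apply: contrapT => h; have : subset_ (psi y) (psi x).
  by move=> b yb; apply: contrapT => nb; apply: h; exists b.
by move/le => yx; move: (lt_le_trans xy yx); rewrite ltxx.
Qed.

(** A chain of length n in X starts at an element mapped to the zero ideal; otherwise the zero ideal
    could be put in front of its image, giving n + 1 strict inclusions of primes. As n is at least
    2, two more elements follow. *)
Lemma emb_chain : exists e c1 c2, [/\ subset_ (psi e) (fun x => x = 0), (e < c1)%O & (c1 < c2)%O].
Proof.
have [[s [ss szs]] _] := dimT; have : (2 < size s)%N by rewrite szs.
case: s ss szs => [|e [|c1 [|c2 s]]] // ss szs _.
exists e, c1, c2; move: (ss) => /= /and3P[ec1 c12 _]; split=> // x ex.
apply/eqP; apply: contrapT => /negP x0; have [_] := dimB; apply.
pose t := [:: e, c1, c2 & s].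
exists (fun i => if i is k.+1 then psi (nth e t k) else fun x => x = 0).
have [pp _] := emb; split.
  by case=> [|k] _; [apply: zero_prime | apply: pp].
move=> [_|k]; last first.
  by rewrite ltnS => kn; apply: emb_lt; apply: (sortedP e ss); rewrite szs.
split; last by exists x; split=> //; apply/eqP.
by move=> y ->; have [] := primeT_ideal (pp e).
Qed.

Section Least.
Variable e : T.
Hypothesis e0 : subset_ (psi e) (fun x => x = 0).

Lemma e_least (y : T) : (e <= y)%O.
Proof.
have [pp [le _]] := emb; apply/le => x /e0->.
by have [] := primeT_ideal (pp y).
Qed.

Lemma ht1_covr (x : T) : ht_eq x 1 <-> covr e x.
Proof.
have emin : minimal e.
  by move=> y ye; apply/eqP; rewrite eq_le ye e_least.
have min_e y : minimal y -> y = e by move=> /(_ e (e_least y)).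
split=> [[[x0 [s [[mx0 [ps ls]] sz1]]] _]|cx].
  case: s ps ls sz1 => [|y [|z s]] //=.
  by rewrite andbT (min_e x0 mx0) => h <-.
split; first by exists e, [:: x]; split=> //; split=> //=; rewrite cx.
move=> x0 s [/min_e-> [ps ls]]; case: s ps ls => [|y1 [|y2 s]] //=.
move=> /and3P[c1 c2 ps] ls.
have le_last (z : T) (r : seq T) : path covr z r -> (z <= last z r)%O.
  elim: r z => //= w r IH z /andP[/andP[zw _] /IH]; apply: le_trans; exact: ltW.
have /andP[_ /forallP/(_ y1)] := cx.
have /andP[-> _] := c1; have /andP[y12 _] := c2.
by rewrite -ls (lt_le_trans y12 (le_last _ _ ps)).
Qed.

Lemma covr_below (y : T) : (e < y)%O -> exists z, covr e z /\ (z <= y)%O.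
Proof.
have [k] := ubnP #|[set w | (w < y)%O]|; elim: k y => // k IH y szy ey.
have [cy|] := boolP (covr e y); first by exists y.
rewrite /covr ey negb_forall => /existsP[z]; rewrite negbK => /andP[ez zy].
have [||w [cw wz]] := IH z => //; last by exists w; split=> //; apply: le_trans wz (ltW zy).
apply: leq_trans (proper_card _) _; last exact: szy.
apply/properP; split; last by exists z; rewrite !inE ?zy ?ltxx.
by apply/subsetP => w; rewrite !inE => wz; apply: lt_trans zy.
Qed.

Lemma ht1_le (x y : T) : ht_eq x 1 -> ht_eq y 1 -> (x <= y)%O -> x = y.
Proof.
move=> /ht1_covr/andP[ex _] /ht1_covr/andP[_ /forallP/(_ x)].
by rewrite ex /= lt_neqAle => + xy; rewrite xy andbT negbK => /eqP.
Qed.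

(** x covers e, whose image is the zero ideal, and saturation leaves no prime strictly between. *)
Lemma ht1_min (x : T) P : ht_eq x 1 -> is_prime (@setTB B) P -> strict_sub P (psi x) ->
  subset_ P (fun z => z = 0).
Proof.
have [pp [_ sat]] := emb.
move=> /ht1_covr/sat[_ no] Pp Px y Py; apply: contrapT => y0.
apply: no; exists P; split=> //; split=> //; split.
  by move=> z /e0->; have [] := primeT_ideal Pp.
by exists y; split=> // /e0.
Qed.

Lemma ht1_neq0 (x : T) : ht_eq x 1 -> ~ subset_ (psi x) (fun z => z = 0).
Proof.
have [_ [le _]] := emb.
move=> /ht1_covr/andP[ex _] h; have : (x <= e)%O.
  by apply/le => z /h->; have [pp _] := emb; have [] := primeT_ideal (pp e).
by move/(lt_le_trans ex); rewrite ltxx.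
Qed.

End Least.
End Heights.

(** * Assembly of the factorial domain A and its properties *)

Unset Implicit Arguments.

Theorem mainTheorem16
  (d : Order.disp_t) (T : finPOrderType d) (n : nat)
  (B : idomainType) (M : B -> Prop) (psi : T -> B -> Prop) :
  (2 <= n)%N ->
  poset_dim_eq (T := T) n ->
  unique_min (T := T) -> unique_max (T := T) ->
  is_local (@setTB B) M ->
  contains_Q B ->
  ~ (exists s : nat -> B, forall b, exists k, M (b - s k)) ->
  (exists h : B -> B, (forall x y, M (h x - h y) -> x = y) /\
                      (forall b, exists x, M (h x - b))) ->
  depth_ge M 2 ->
  saturated_embedding psi ->
  krull_dim_eq B n ->
  (forall x Q b, ht_eq x 1 -> is_prime (@setTB B) Q -> strict_sub (psi x) Q ->
     (forall q, ass_quot b q -> ~ subset_ Q q) /\ loc_depth_ge Q 2) ->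
  exists (A : B -> Prop) (xt : T -> B),
    is_subring A /\
    is_local A (fun a => M a /\ A a) /\
    is_ufd A /\
    completion_iso A (fun a => M a /\ A a) M /\
    (forall x, ht_eq x 1 -> A (xt x) /\ xt x != 0 /\
       same_ (fun b => psi x b /\ A b) (fun b => exists a, A a /\ b = xt x * a)) /\
    (forall x y, ht_eq x 1 -> ht_eq y 1 -> xt x = xt y -> x = y) /\
    (forall x y, ht_eq x 1 ->
       ((x <= y)%O <-> subset_ (fun b => psi x b /\ A b) (fun b => psi y b /\ A b))) /\
    (forall P', is_prime A P' ->
       exists P, is_prime (@setTB B) P /\ same_ (fun b => A b /\ P b) P') /\
    (forall P, is_prime (@setTB B) P ->
       (exists x, ht_eq x 1 /\ strict_sub (psi x) P) ->
       same_ P (ideal_span (@setTB B) (fun b => A b /\ P b))) /\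
    (forall P1 P2, is_prime (@setTB B) P1 -> is_prime (@setTB B) P2 ->
       (exists x, ht_eq x 1 /\ strict_sub (psi x) P1) ->
       (exists x, ht_eq x 1 /\ strict_sub (psi x) P2) ->
       same_ (fun b => A b /\ P1 b) (fun b => A b /\ P2 b) ->
       same_ P1 P2).
Proof.
move=> n2 dimT _ _ locB QB uncount [h [h_inj h_surj]] _ emb dimB hyp.
have [psip [psile _]] := emb.
have hdeep x Q : ht_eq x 1 -> is_prime (@setTB B) Q -> strict_sub (psi x) Q -> deep Q.
  by move=> hx Qp xQ b q; have [h1 _] := hyp x Q b hx Qp xQ; apply: h1.
have [e [c1 [c2 [e0 ec1 c12]]]] := emb_chain n2 dimT emb dimB.
(* M strictly contains psi z for an element z of height one below c1, because psi c1 is strictly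
   smaller than psi c2. *)
have deepM : deep M.
  have [z [cz zc1]] := covr_below ec1.
  apply: (hdeep z M); [exact/(ht1_covr emb e0) | exact: (local_prime locB)|].
  have [sub [y [yc2 ny]]] := emb_lt emb c12.
  split=> [b /(proj1 (psile _ _) zc1)/sub|]; first exact: (prime_local locB).
  exists y; split; first exact: (prime_local locB) yc2.
  by move=> zy; apply: ny; apply: (proj1 (psile _ _) zc1).
pose xs := [seq x <- enum T | `[< ht_eq x 1 >]].
have xsP x : x \in xs <-> ht_eq x 1.
  rewrite mem_filter mem_enum andbT; split; [exact: asboolW | exact: asboolT].
(* The generator for x is to avoid psi y for every y not above x; this recovers the order relation
   in A and separates the generators. *)
pose far (x : T) (q : B -> Prop) := exists y, ~ (x <= y)%O /\ q = psi y.
pose Init (S : satsub B) := exists xt : T -> B, forall x, ht_eq x 1 ->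
  [/\ sprime S (xt x), psi x (xt x) & forall y, ~ (x <= y)%O -> ~ psi y (xt x)].
have initE (J : Type) (dc : J -> seq J) (D : J -> Prop) :
    code_closed dc D -> small M D -> exists A0 : satsub B, [/\ good A0, sz D A0 & Init A0].
  move=> cD sD.
  have [||||||S [xt [gS sS hS]]] := @initial_ring J dc D cD B M QB locB sD T psi xs far.
  - by [].
  - by move=> x /xsP hx; apply: (ht1_neq0 emb e0 hx).
  - move=> x b Q /xsP hx xQ hQ; have [Qp _] := hQ.
    by have [h1 _] := hyp x Q b hx Qp xQ; apply: (h1 Q hQ).
  - by move=> x _; apply: sz_img; apply: (sz_count cD).
  - move=> x q _ [y [nxy ->]]; split=> // sub.
    by apply: nxy; apply/psile.
  - move=> x y /xsP hx /xsP hy /eqP ne; exists y; split=> // xy.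
    exact/ne/(ht1_le emb e0 hx hy xy).
  exists S; split=> //; exists xt => x hx.
  have [h1 h2 h3] := hS x (proj2 (xsP x) hx).
  by split=> // y nxy; apply: h3; exists y.
have [A0 [A [[xt hxt] gA [_ extA] tA]]] := tower locB uncount h_inj h_surj deepM initE.
have hA := good_ring gA.
have primeA P : is_prime (@setTB B) P -> deep P ->
    same_ P (ideal_span (@setTB B) (fun b => A b /\ P b)).
  (* By extensionality P is the span of a finite list, so it occurs among the tasks. *)
  move=> Pp; have [l [_ /predeqP Pl]] := local_noeth locB (proj1 Pp).
  by move: Pp; rewrite Pl => Pp Pd; have [_ _ h3] := tA l; apply: h3.
have residue b : exists a, A a /\ M (b - a) by have [h1 _ _] := tA [:: b].
have contract l c : (forall a, a \in l -> A a) -> A c ->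
    ideal_span (@setTB B) (seq_set l) c -> ideal_span A (seq_set l) c.
  move=> lA Ac hc; have [_ h2 _] := tA (c :: l); apply: h2 => //.
  by move=> a; rewrite inE => /orP[/eqP->|/lA].
have maxgen := primeA M (local_prime locB) deepM.
exists A, xt; split; first exact: hA.
split; first exact: (sub_local locB contract).
split; first exact: (ufd_of_good gA).
split; first exact: (completion locB residue contract maxgen).
have sxt x : ht_eq x 1 -> sprime A (xt x).
  by move=> hx; apply: extA; have [] := hxt x hx.
split.
  move=> x hx; have [Ax x0 nx dich] := sxt x hx; have [_ px _] := hxt x hx.
  split=> //; split=> // b; split=> [[pb Ab]|[a [Aa ->]]].
    (* An element of psi x in A that is not a multiple of the generator would be regular modulo it,
       which is impossible inside a height one prime. *)
    have [[a ea]|] := dich b Ab.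
      by exists a; split=> //; apply: (good_sat gA Ax x0); rewrite -ea.
    move=> r; exfalso; apply: (height_one_zero_divisor (local_noeth locB) (psip x) _ px x0 pb r).
    by move=> P Pp; apply: (ht1_min emb e0).
  split; last exact: (subM hA).
  by have [_ _ hM] := primeT_ideal (psip x); rewrite mulrC; apply: hM.
split.
  move=> x y hx hy exy; apply: contrapT => ne.
  have [_ px nx] := hxt x hx; have [_ py _] := hxt y hy.
  apply: (nx y); last by rewrite exy.
  by move/(ht1_le emb e0 hx hy)/ne.
split.
  move=> x y hx; split=> [/psile sub b [pb Ab]|sub]; first by split=> //; apply: sub.
  have [_ px nx] := hxt x hx; have [Ax _ _ _] := sxt x hx.
  apply: contrapT => nxy; apply: (nx y nxy).
  by have [] := sub (xt x) (conj px Ax).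
split; first by move=> P'; apply: (spec_onto locB contract).
have gen P : is_prime (@setTB B) P -> (exists x, ht_eq x 1 /\ strict_sub (psi x) P) ->
    same_ P (ideal_span (@setTB B) (fun b => A b /\ P b)).
  by move=> Pp [x [hx xP]]; apply: primeA => //; apply: hdeep hx Pp xP.
split=> // P1 P2 P1p P2p /(gen P1 P1p) g1 /(gen P2 P2p) g2 /predeqP e12 b.
by split=> [/g1|/g2] hb; [apply/g2 | apply/g1]; move: hb; rewrite e12.
Qed.
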